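(* Let $h:M^{2}\rightarrow Q^{3}$ be a minimal isometric immersion of a $2$-dimensional, oriented Riemannian manifold $M^{2}$ into an umbilical hypersurface $Q^{3}$ of $\mathbb{H}^{4}$, and let $F_h:M^2\times\mathbb{R}\to\mathbb{H}^4$ be the suspension of $h$. Then: (i) On the open subset of its regular points, $F_{h}$ is a minimal immersion in $\mathbb{H}^{4}$ with Gauss-Kronecker curvature identically zero. (ii) The metric induced on $M^{2}\times \mathbb{R}$ by $F_{h}$ is complete (in particular Riemannian, i.e. $F_h$ is an immersion) if and only if $M^{2}$ is complete and $Q^{3}$ is a horosphere or an equidistant hypersurface in $\mathbb{H}^{4}$.
   Context: All manifolds are connected. $\mathbb{R}_{1}^{5}$ is $\mathbb{R}^{5}$ with the Lorentzian metric $\langle x,y\rangle =-x_{0}y_{0}+\sum_{i=1}^{4}x_{i}y_{i}$, and $\mathbb{H}^{4}=\{x\in \mathbb{R}_{1}^{5}:\langle x,x\rangle =-1,\ x_{0}>0\}$. An umbilical hypersurface $Q^3$ of $\mathbb{H}^{4}$ is an intersection of $\mathbb{H}^{4}$ with an affine hyperplane of $\mathbb{R}_{1}^{5}$ (of dimension 3); it has constant sectional curvature $K_{Q^3}$ and is called a geodesic sphere, a horosphere, or an equidistant hypersurface if $K_{Q^3}$ is positive, zero, or negative, respectively. Suspension: let $\eta$ be a unit normal vector field of $Q^3$ in $\mathbb{H}^4$. The suspension of an isometric immersion $h:M^2\to Q^3$ is $F_{h}:M^{2}\times \mathbb{R}\rightarrow \mathbb{H}^{4}$, $F_{h}(x,t)=\cosh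 t\, h(x)+\sinh t\,(\eta \circ h)(x)$. A regular point of $F_h$ is a point where $dF_h$ is injective. The Gauss-Kronecker curvature of a hypersurface is the product of its principal curvatures. *)

(* Defs.v *)
Set Warnings "-notation-overridden,-notation-incompatible-prefix".
From HB Require Import structures.
From mathcomp Require Import all_boot all_order all_algebra.
From mathcomp Require Import all_classical all_reals all_analysis.
Export numFieldNormedType.Exports.

Set Implicit Arguments.
Unset Strict Implicit.
Unset Printing Implicit Defensive.

Import Order.TTheory GRing.Theory Num.Theory.

Local Open Scope classical_set_scope.
Local Open Scope ring_scope.

Section Smooth.
Context {R : realType}.

Fixpoint iter_derive {V W : normedModType R} (s : seq V) (f : V -> W) : V -> W :=
  if s is v :: s' then iter_derive s' ('D_v f) else f.

(** For [U] open, [f] is of class C^oo on [U] iff all its iterated directional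
    derivatives are Frechet differentiable on [U]. *)
Definition smooth_on {V W : normedModType R} (U : set V) (f : V -> W) : Prop :=
  forall (s : seq V) (x : V), U x -> differentiable (iter_derive s f) x.

Definition partial {n} {W : normedModType R} (i : 'I_n) (f : 'rV[R]_n -> W) :
    'rV[R]_n -> W :=
  'D_(delta_mx 0 i) f.

Definition C1 {n} (u : R -> 'rV[R]_n) : Prop :=
  (forall t, derivable u t 1) /\ continuous (derive1 u).

(** The value at [(v, w)] of the bilinear form with Gram matrix [G]. *)
Definition bilin {n} (G : 'M[R]_n) (v w : 'rV[R]_n) : R := (v *m G *m w^T) 0 0.

End Smooth.

(** A smooth [n]-manifold is a topological space [M] with a (not necessarily
    maximal) atlas [A].  Charts carry only data; their properties are stated in
    [is_chart].  [cinv] is a total function, meaningful on [cimage] only. *)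

Record chart (R : realType) (M : Type) (n : nat) := Chart {
  cdom : set M;
  cmap : M -> 'rV[R]_n;
  cinv : 'rV[R]_n -> M
}.

Section Manifold.
Context {R : realType} {M : topologicalType} {n : nat}.
Implicit Types (c : chart R M n) (A : set (chart R M n)).

Definition cimage c : set 'rV[R]_n := cmap c @` cdom c.

Definition is_chart c : Prop :=
  [/\ open (cdom c),
      open (cimage c),
      forall p, cdom c p -> cinv c (cmap c p) = p,
      forall p, cdom c p -> {for p, continuous (cmap c)} &
      forall x, cimage c x -> {for x, continuous (cinv c)}].

Definition transition c c' : 'rV[R]_n -> 'rV[R]_n := cmap c' \o cinv c.

Definition smooth_atlas A : Prop :=
  [/\ forall c, A c -> is_chart c,
      forall p, exists2 c, A c & cdom c p &
      forall c c', A c -> A c' ->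
        smooth_on (cmap c @` (cdom c `&` cdom c')) (transition c c')].

Definition connected_manifold A : Prop :=
  [/\ hausdorff_space M, second_countable (T := M),
      [set: M] !=set0, connected [set: M] & smooth_atlas A].

Definition oriented_atlas A : Prop :=
  forall c c' p, A c -> A c' -> cdom c p -> cdom c' p ->
    0 < \det (jacobian (transition c c') (cmap c p)).

(** [g c p] is the Gram matrix at [p] of the coordinate frame of the chart [c];
    its value is irrelevant unless [p] is in the domain of [c]. *)
Definition metric : Type := chart R M n -> M -> 'M[R]_n.

Definition riemannian A (g : metric) : Prop :=
  [/\ forall c, A c -> smooth_on (cimage c) (g c \o cinv c),
      forall c p, A c -> cdom c p ->
        (g c p)^T = g c p /\ (forall v, v != 0 -> 0 < bilin (g c p) v v) &
      forall c c' p, A c -> A c' -> cdom c p -> cdom c' p ->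
        let J := jacobian (transition c c') (cmap c p) in
        g c p = J *m g c' p *m J^T].

(** [curve_length A g gam a b L]: the restriction of [gam] to [[a, b]] is a
    piecewise C^1 curve of length [L] for the metric [g].  The interval is cut
    into pieces each of which [gam] maps into the domain of a chart [c], where
    it is C^1 in coordinates, i.e. [cmap c \o gam] has a C^1 extension [u] from
    the piece to the real line. *)
Inductive curve_length A (g : metric) (gam : R -> M) : R -> R -> R -> Prop :=
| curve_length_nil a : curve_length A g gam a a 0
| curve_length_cons a b b' c (u : R -> 'rV[R]_n) L :
    a < b -> A c -> C1 u ->
    (forall t, a <= t <= b -> cdom c (gam t) /\ cmap c (gam t) = u t) ->
    curve_length A g gam b b' L ->
    curve_length A g gam a b'
      (\int[lebesgue_measure]_(t in `[a, b])
          Num.sqrt (bilin (g c (gam t)) (derive1 u t) (derive1 u t)) + L).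

Definition riemannian_distance A (g : metric) (p q : M) : \bar R :=
  ereal_inf [set L%:E | L in [set L : R | exists (gam : R -> M) (a b : R),
    [/\ gam a = p, gam b = q & curve_length A g gam a b L]]].

Definition complete A (g : metric) : Prop :=
  let d := riemannian_distance A g in
  forall u : nat -> M,
    (forall e : R, 0 < e -> exists N, forall i j, (N <= i)%N -> (N <= j)%N ->
      (d (u i) (u j) < e%:E)%E) ->
    exists p, forall e : R, 0 < e -> exists N, forall i, (N <= i)%N ->
      (d (u i) p < e%:E)%E.

End Manifold.
Arguments metric : clear implicits.

(** The product atlas on [M * R], made of the charts [c * id]. *)
Definition prod_chart {R : realType} {M : Type} {n} (c : chart R M n) :
    chart R (M * R) (n + 1) :=
  {| cdom := cdom c `*` [set: R];
     cmap := fun p => row_mx (cmap c p.1) p.2%:M;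
     cinv := fun x => (cinv c (lsubmx x), rsubmx x 0 0) |}.

Definition prod_atlas {R : realType} {M : Type} {n} (A : set (chart R M n)) :
    set (chart R (M * R) (n + 1)) :=
  prod_chart @` A.

Section Curvature.
Context {R : realType} {n : nat}.
Implicit Types (G : 'rV[R]_n -> 'M[R]_n) (x : 'rV[R]_n) (i j k l : 'I_n).

(** nabla_(d_i) d_j = \sum_k (christoffel G i j k) d_k *)
Definition christoffel G i j k x : R :=
  2^-1 * \sum_l invmx (G x) k l *
    (partial i (fun y => G y j l : R) x + partial j (fun y => G y i l : R) x
     - partial l (fun y => G y i j : R) x).

(** R(d_i, d_j) d_k = \sum_l (curvature_coef G i j k l) d_l, where
    R(X, Y) = nabla_X nabla_Y - nabla_Y nabla_X - nabla_[X, Y] *)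
Definition curvature_coef G i j k l x : R :=
  partial i (christoffel G j k l) x - partial j (christoffel G i k l) x
  + \sum_m (christoffel G j k m x * christoffel G i m l x
            - christoffel G i k m x * christoffel G j m l x).

Definition curvature G x (u v w : 'rV[R]_n) : 'rV[R]_n :=
  \row_l \sum_i \sum_j \sum_k
    u 0 i * v 0 j * w 0 k * curvature_coef G i j k l x.

Definition sectional_curvature G x (v w : 'rV[R]_n) : R :=
  bilin (G x) (curvature G x v w w) v /
  (bilin (G x) v v * bilin (G x) w w - bilin (G x) v w ^+ 2).

End Curvature.

Section Lorentz.
Context {R : realType}.
Notation E := 'rV[R]_5.

Definition lorentz (x y : E) : R :=
  - (x 0 0 * y 0 0) + \sum_(i < 4) x 0 (lift ord0 i) * y 0 (lift ord0 i).

Definition gram {n} (f : 'rV[R]_n -> E) (x : 'rV[R]_n) : 'M[R]_n :=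
  \matrix_(i, j) lorentz (partial i f x) (partial j f x).

Section Immersions.
Context {M : topologicalType} {n : nat}.
Implicit Types (A : set (chart R M n)) (c : chart R M n) (f : M -> E).

Definition local_expr f c : 'rV[R]_n -> E := f \o cinv c.

Definition smooth_map A f : Prop :=
  forall c, A c -> smooth_on (cimage c) (local_expr f c).

Definition regular_point A f : set M := [set p |
  forall c, A c -> cdom c p -> injective ('d (local_expr f c) (cmap c p))].

Definition immersion A f : Prop :=
  smooth_map A f /\ forall p, regular_point A f p.

Definition induced_metric f : metric R M n :=
  fun c p => gram (local_expr f c) (cmap c p).

Definition isometric_immersion A (g : metric R M n) (N : set E) f : Prop :=
  [/\ immersion A f, forall p, N (f p) &
      forall c p, A c -> cdom c p -> induced_metric f c p = g c p].

(** Below, [f] takes values in a submanifold of R^5_1 whose tangent space at [x]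
    is [T x], and [f] has codimension one in that submanifold. *)
Definition unit_normal (T : E -> set E) A f (p : M) (xi : E) : Prop :=
  [/\ T (f p) xi,
      forall c v, A c -> cdom c p ->
        lorentz ('d (local_expr f c) (cmap c p) v) xi = 0 &
      lorentz xi xi = 1].

(** The Levi-Civita connection of the submanifold is the tangential part of the
    flat connection of R^5_1 and [xi] is tangent to the submanifold, so that the
    second fundamental form is the [xi]-component of the flat derivative. *)
Definition second_fundamental_form f c p (xi : E) : 'M[R]_n :=
  \matrix_(i, j)
    lorentz (partial i (partial j (local_expr f c)) (cmap c p)) xi.

(** Acts on row vectors: II(v, w) = <v *m shape_operator, w>. *)
Definition shape_operator f c p (xi : E) : 'M[R]_n :=
  second_fundamental_form f c p xi *m invmx (induced_metric f c p).

(** The eigenvalues of the shape operator, with multiplicity. *)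
Definition principal_curvatures f c p (xi : E) (k : n.-tuple R) : Prop :=
  char_poly (shape_operator f c p xi) = \prod_(i < n) ('X - (tnth k i)%:P).

Definition mean_curvature f c p (xi : E) : R :=
  n%:R^-1 * \tr (shape_operator f c p xi).

Definition gauss_kronecker_curvature f c p (xi : E) (K : R) : Prop :=
  exists2 k, principal_curvatures f c p xi k & K = \prod_(i < n) tnth k i.

Definition minimal_on (T : E -> set E) A f (D : set M) : Prop :=
  forall p c xi, D p -> A c -> cdom c p -> unit_normal T A f p xi ->
    mean_curvature f c p xi = 0.

Definition zero_gauss_kronecker_on (T : E -> set E) A f (D : set M) : Prop :=
  forall p c xi, D p -> A c -> cdom c p -> unit_normal T A f p xi ->
    gauss_kronecker_curvature f c p xi 0.

End Immersions.

Definition H4 : set E := [set x | lorentz x x = -1 /\ 0 < x 0 0].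

Definition tangent_H4 (x : E) : set E := [set v | lorentz x v = 0].

(** The form being nondegenerate, every affine hyperplane of R^5_1 is
    [hyperplane a b] for some [a != 0] and [b]. *)
Definition hyperplane (a : E) (b : R) : set E := [set x | lorentz a x = b].

Definition umbilical (a : E) (b : R) : set E := H4 `&` hyperplane a b.

Definition tangent_umbilical (a : E) (x : E) : set E :=
  [set v | lorentz x v = 0 /\ lorentz a v = 0].

(** [row_free] says that [x] and [a] are linearly independent, i.e. that the
    intersection is transverse at [x], its tangent space having dimension 3.
    It excludes the intersections consisting of a single point. *)
Definition umbilical_hypersurface (a : E) (b : R) : Prop :=
  [/\ a != 0, umbilical a b !=set0 &
      forall x, umbilical a b x -> row_free (col_mx x a)].

Definition unit_normal_field (a : E) (b : R) (eta : E -> E) : Prop :=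
  {within umbilical a b, continuous eta} /\
  forall x, umbilical a b x ->
    [/\ tangent_H4 x (eta x),
        forall v, tangent_umbilical a x v -> lorentz v (eta x) = 0 &
        lorentz (eta x) (eta x) = 1].

(** The 3-dimensional hypersurface [Q] has constant sectional curvature [K],
    computed in its regular local parametrizations. *)
Definition constant_curvature (Q : set E) (K : R) : Prop :=
  forall (U : set 'rV[R]_3) (phi : 'rV[R]_3 -> E),
    open U -> smooth_on U phi ->
    (forall x, U x -> Q (phi x) /\ injective ('d phi x)) ->
    forall x (v w : 'rV[R]_3), U x -> row_free (col_mx v w) ->
      sectional_curvature (gram phi) x v w = K.

Definition horosphere (Q : set E) : Prop := constant_curvature Q 0.

Definition equidistant (Q : set E) : Prop :=
  exists2 K, K < 0 & constant_curvature Q K.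

Definition cosh (t : R) : R := (expR t + expR (- t)) / 2.
Definition sinh (t : R) : R := (expR t - expR (- t)) / 2.

Definition suspension {M : Type} (eta : E -> E) (h : M -> E) (p : M * R) : E :=
  cosh p.2 *: h p.1 + sinh p.2 *: eta (h p.1).

End Lorentz.

(* Main.v *)
Require Import Defs.
From HB Require Import structures.
From mathcomp Require Import all_boot all_order all_algebra.
From mathcomp Require Import all_classical all_reals all_analysis.
From mathcomp Require Import ring lra.

Set Implicit Arguments.
Unset Strict Implicit.
Unset Printing Implicit Defensive.

Import Order.TTheory GRing.Theory Num.Theory.

Local Open Scope classical_set_scope.
Local Open Scope ring_scope.

(** A unit normal of [Q] in H^4 lies in the span of the position [x] and of [a], so that along
    the connected [M] it is [al (a + b x)] with a constant [al]; with [be = al b] the suspension is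
    [F (x, t) = mu t h(x) + al (sinh t) a], where [mu t = cosh t + be sinh t].  Hence its metric is
    the warped product [mu^2 g + dt^2] and its second fundamental form is that of [h] times [mu],
    bordered by zeros: the regular points are those where [mu] does not vanish, and there the
    principal curvatures are [k / mu], [- k / mu], [0].  By the Gauss equation [Q] has curvature
    [be^2 - 1], and [mu] has no zero iff [be^2 <= 1].  In that case heights are 1-Lipschitz for
    the distance of [M * R], and on bounded ranges of heights, where [mu] is bounded above and
    away from 0, curves in [M] and in [M * R] have comparable lengths, so that completeness passes
    from each metric to the other. *)

(** * Smooth functions *)

(** The definitions shape the work. Sectional curvature is intrinsic, through Christoffel symbols,
    while [Q] is given extrinsically. The bridge is that the tangential part of the second
    derivatives of a parametrization has the Christoffel symbols as coefficients; commuting third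
    derivatives then yields the Gauss equation. [constant_curvature] quantifies over
    parametrizations and says nothing about a set without any, so reading off the sign of the
    curvature requires an explicit parametrization of [Q]. Principal curvatures are the roots of a
    characteristic polynomial that must split over the reals: this is where self-adjointness of the
    shape operator of [h] enters, since a traceless 2 by 2 matrix splits iff its determinant is
    nonpositive. Completeness is metric, by Cauchy sequences for an infimum of lengths, so it is
    transferred by moving curves between [M] and [M * R], without geodesics. In the direct half of
    (ii), positive definiteness of the metric gives the condition on [Q] and thereby [mu > 0], which
    the comparison of lengths needs. *)

Section SmoothClosure.
Context {R : realType} {V : normedModType R}.
Implicit Types (U : set V) (f g : V -> R).

Lemma iter_derive_ext {W : normedModType R} U (s : seq V) (f g : V -> W) :
  open U -> {in U, f =1 g} -> {in U, iter_derive s f =1 iter_derive s g}.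
Proof.
move=> oU; elim: s f g => [|v s IH] f g fg //=.
apply: IH => x; rewrite inE => Ux; apply: near_eq_derive.
have : nbhs x U by exact: open_nbhs_nbhs.
by apply: filterS => y Uy; apply: fg; rewrite inE.
Qed.

Lemma near_eq_differentiable {W : normedModType R} (f g : V -> W) x :
  (\forall y \near x, f y = g y) -> differentiable f x -> differentiable g x.
Proof.
move=> fg /diff_locallyP[cdf fE].
have gE : g \o shift x = cst (g x) + 'd f x +o_ (0 : V) id.
  apply/eqaddoP => e e0; move/eqaddoP : fE => /(_ e e0).
  have fg0 : \forall h \near (0 : V), f (h + x) = g (h + x).
    by move: fg; rewrite (near_shift (0 : V)) subr0.
  apply: filter_app; near=> h.
  by rewrite !fctE /= -(nbhs_singleton fg) (near fg0 h).
by apply/diff_locallyP; rewrite (diff_unique cdf gE).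
Unshelve. all: by end_near. Qed.

Lemma smooth_on_ext {W : normedModType R} U (f g : V -> W) :
  open U -> {in U, f =1 g} -> smooth_on U f -> smooth_on U g.
Proof.
move=> oU fg sf s x Ux; apply: near_eq_differentiable (sf s x Ux).
have : nbhs x U by exact: open_nbhs_nbhs.
by apply: filterS => y Uy; rewrite (iter_derive_ext s oU fg) // inE.
Qed.

Lemma smooth_on_differentiable {W : normedModType R} U (f : V -> W) x :
  smooth_on U f -> U x -> differentiable f x.
Proof. by move=> sf; exact: (sf [::]). Qed.

Lemma smooth_on_derive {W : normedModType R} U (f : V -> W) v :
  smooth_on U f -> smooth_on U ('D_v f).
Proof. by move=> sf s; exact: (sf (v :: s)). Qed.

(** A class closed under the operations and, up to equality on [U], under directional derivatives.
    Its members are differentiable on [U], so one induction on the list of directions puts the whole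
    class inside [smooth_on], with no formula for iterated derivatives of products or inverses. *)
Inductive smooth_gen U : (V -> R) -> Prop :=
| smooth_gen_base f : smooth_on U f -> smooth_gen U f
| smooth_gen_cst k : smooth_gen U (cst k)
| smooth_gen_add f g : smooth_gen U f -> smooth_gen U g ->
    smooth_gen U (fun x => f x + g x)
| smooth_gen_mul f g : smooth_gen U f -> smooth_gen U g ->
    smooth_gen U (fun x => f x * g x)
| smooth_gen_exp f : smooth_gen U f -> smooth_gen U (fun x => expR (f x))
| smooth_gen_inv f : (forall x, U x -> f x != 0) -> smooth_gen U f ->
    smooth_gen U (fun x => (f x)^-1).

Lemma differentiable_expR (x : R) : differentiable (@expR R) x.
Proof. by apply/derivable1_diffP; exact: derivable_expR. Qed.

Lemma smooth_gen_differentiable U f x :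
  smooth_gen U f -> U x -> differentiable f x.
Proof.
move=> gf Ux; elim: gf => {f}.
- by move=> f sf; exact: (smooth_on_differentiable sf).
- by move=> k; exact: differentiable_cst.
- by move=> f g _ df _ dg; exact: differentiableD.
- by move=> f g _ df _ dg; exact: differentiableM.
- move=> f _ df.
  by apply: (@differentiable_comp _ _ _ _ f expR) => //; exact: differentiable_expR.
- by move=> f f0 _ df; apply: differentiableV => //; exact: f0.
Qed.

Lemma derive_expR_comp f x v : differentiable f x ->
  'D_v (fun y => expR (f y)) x = 'D_v f x * expR (f x).
Proof.
move=> df; have de := @differentiable_expR (f x).
rewrite (deriveE _ df) (@deriveE _ _ _ (expR \o f)); last first.
  exact: differentiable_comp.
rewrite diff_comp //=.
have e : 'd expR (f x) 1 = expR (f x) by rewrite -deriveE // derive_val.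
by rewrite -[X in 'd expR _ X]mulr1 [LHS]linearZ/= e.
Qed.

Lemma smooth_gen_derive U f v : open U -> smooth_gen U f ->
  exists2 g, smooth_gen U g & {in U, 'D_v f =1 g}.
Proof.
move=> oU gf; elim: gf => {f}.
- by move=> f sf; exists ('D_v f) => //; exact/smooth_gen_base/smooth_on_derive.
- move=> k; exists (cst 0); first exact: smooth_gen_cst.
  by move=> x _; rewrite derive_cst.
- move=> f g gf [f' gf' ff'] gg [g' gg' ge].
  exists (fun x => f' x + g' x); first exact: smooth_gen_add.
  move=> x Ux; rewrite -ff' // -ge //; move: Ux; rewrite inE => Ux.
  by rewrite (@deriveD _ _ _ f g) //; apply: diff_derivable;
     exact: (smooth_gen_differentiable _ Ux).
- move=> f g gf [f' gf' ff'] gg [g' gg' ge].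
  exists (fun x => f x * g' x + g x * f' x).
    by apply: smooth_gen_add; apply: smooth_gen_mul.
  move=> x Ux; rewrite -ff' // -ge //; move: Ux; rewrite inE => Ux.
  by rewrite (@deriveM _ _ f g) //; apply: diff_derivable;
     exact: (smooth_gen_differentiable _ Ux).
- move=> f gf [f' gf' ff'].
  exists (fun x => f' x * expR (f x)).
    by apply: smooth_gen_mul => //; exact: smooth_gen_exp.
  move=> x Ux; rewrite -ff' //; move: Ux; rewrite inE => Ux.
  by apply: derive_expR_comp; exact: (smooth_gen_differentiable _ Ux).
- move=> f f0 gf [f' gf' ff'].
  exists (fun x => (cst (-1) x * f' x) * ((f x)^-1 * (f x)^-1)).
    by do 2! apply: smooth_gen_mul => //; do ?[exact: smooth_gen_cst|exact: smooth_gen_inv].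
  move=> x Ux; rewrite -ff' //; move: Ux; rewrite inE => Ux.
  rewrite (@deriveV _ _ f) //; first by rewrite /cst mulN1r mulNr mulrC -invfM -expr2 -mulNr.
    exact: f0.
  by apply: diff_derivable; exact: (smooth_gen_differentiable _ Ux).
Qed.

Lemma smooth_gen_smooth U f : open U -> smooth_gen U f -> smooth_on U f.
Proof.
move=> oU gf s.
suff [g gg fg] : exists2 g, smooth_gen U g & {in U, iter_derive s f =1 g}.
  move=> x Ux; apply: (@near_eq_differentiable _ g); last first.
    exact: (smooth_gen_differentiable gg Ux).
  have : nbhs x U by exact: open_nbhs_nbhs.
  by apply: filterS => y Uy; rewrite fg // inE.
elim: s f gf => [|v s IH] f gf /=; first by exists f.
have [g gg fg] := smooth_gen_derive v oU gf.
have [k gk gek] := IH _ gg; exists k => // x Ux.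
by rewrite (iter_derive_ext s oU fg) // gek.
Qed.

Lemma smooth_on_cst U (k : R) : open U -> smooth_on U (cst k : V -> R).
Proof. by move=> oU; apply: smooth_gen_smooth => //; exact: smooth_gen_cst. Qed.

Lemma smooth_onD U f g : open U -> smooth_on U f -> smooth_on U g ->
  smooth_on U (fun x => f x + g x).
Proof.
move=> oU sf sg; apply: smooth_gen_smooth => //.
by apply: smooth_gen_add; exact: smooth_gen_base.
Qed.

Lemma smooth_onM U f g : open U -> smooth_on U f -> smooth_on U g ->
  smooth_on U (fun x => f x * g x).
Proof.
move=> oU sf sg; apply: smooth_gen_smooth => //.
by apply: smooth_gen_mul; exact: smooth_gen_base.
Qed.

Lemma smooth_on_expR U f : open U -> smooth_on U f ->
  smooth_on U (fun x => expR (f x)).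
Proof.
by move=> oU sf; apply: smooth_gen_smooth => //; exact/smooth_gen_exp/smooth_gen_base.
Qed.

Lemma smooth_onV U f : open U -> (forall x, U x -> f x != 0) ->
  smooth_on U f -> smooth_on U (fun x => (f x)^-1).
Proof.
by move=> oU f0 sf; apply: smooth_gen_smooth => //; exact/smooth_gen_inv/smooth_gen_base.
Qed.

Lemma smooth_on_sum (I : Type) (r : seq I) U (F : I -> V -> R) : open U ->
  (forall i, smooth_on U (F i)) -> smooth_on U (fun x => \sum_(i <- r) F i x).
Proof.
move=> oU sF; elim: r => [|i r IH].
  apply: (@smooth_on_ext _ _ (cst 0)) => //; last exact: smooth_on_cst.
  by move=> x _; rewrite big_nil.
apply: (@smooth_on_ext _ _ (fun x => F i x + \sum_(j <- r) F j x)) => //.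
  by move=> x _; rewrite big_cons.
exact: smooth_onD.
Qed.

End SmoothClosure.

(** * Matrix-valued functions and symmetry of second derivatives *)

Section SmoothMatrix.
Context {R : realType}.

(** The two difference quotients coincide as functions, so their limits agree whatever the
    regularity of [f]. *)
Lemma derive_comp_linear {V V' W : normedModType R} (L : {linear V -> V'})
    (f : V' -> W) v x : 'D_v (f \o L) x = 'D_(L v) f (L x).
Proof.
rewrite /derive; set g1 := fun k => _; set g2 := fun k => _.
suff -> : g1 = g2 by [].
by apply: funext => k; rewrite /g1 /g2 /= linearP.
Qed.

Lemma smooth_on_comp_linear {V V' W : normedModType R} (L : {linear V -> V'})
    (U : set V') (f : V' -> W) :
  continuous L -> smooth_on U f -> smooth_on (L @^-1` U) (f \o L).
Proof.
move=> cL sf s.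
have -> : iter_derive s (f \o L) = iter_derive (map L s) f \o L.
  elim: s f {sf} => [|v s IH] f //=.
  rewrite -IH; congr iter_derive; apply: funext => x; exact: derive_comp_linear.
move=> x Ux; have dL : differentiable L x by exact/linear_differentiable/cL.
by apply: differentiable_comp => //; exact: sf.
Qed.

Lemma differentiable_mx {V : normedModType R} {m n} (f : V -> 'M[R]_(m, n)) x :
  (forall i j, differentiable (fun y => f y i j : R) x) -> differentiable f x.
Proof.
move=> df; rewrite (_ : f = \sum_(i < m) \sum_(j < n)
    (fun y => f y i j *: (delta_mx i j : 'M[R]_(m, n)))); last first.
  apply: funext => y; rewrite [LHS]matrix_sum_delta fct_sumE.
  by apply: eq_bigr => i _; rewrite fct_sumE.
apply: differentiable_sum => i; apply: differentiable_sum => j.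
exact: differentiableZl.
Qed.

Lemma differentiable_entry {V : normedModType R} {m n} (f : V -> 'M[R]_(m, n)) x i j :
  differentiable f x -> differentiable (fun y => f y i j : R) x.
Proof.
move=> df; apply: (@differentiable_comp _ _ _ _ f (fun N : 'M[R]_(m, n) => N i j : R)) => //.
exact: differentiable_coord.
Qed.

Lemma derive_entry {V : normedModType R} {m n} (f : V -> 'M[R]_(m, n)) x v i j :
  differentiable f x -> 'D_v f x i j = 'D_v (fun y => f y i j : R) x.
Proof. by move=> df; rewrite derive_mx ?mxE //; exact: diff_derivable. Qed.

Lemma smooth_on_mx {V : normedModType R} {m n} (U : set V) (f : V -> 'M[R]_(m, n)) :
  open U -> (forall i j, smooth_on U (fun y => f y i j : R)) -> smooth_on U f.
Proof.
move=> oU sf s.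
suff E : forall x, U x ->
    forall i j, iter_derive s f x i j = iter_derive s (fun y => f y i j : R) x.
  move=> x Ux; apply: differentiable_mx => i j.
  apply: (@near_eq_differentiable _ _ _ (iter_derive s (fun y => f y i j : R))).
    have : nbhs x U by exact: open_nbhs_nbhs.
    by apply: filterS => y Uy; rewrite E.
  exact: sf.
elim: s f sf => [|v s IH] f sf x Ux i j //=.
have vE i' j' : {in U, 'D_v (fun y => f y i' j' : R) =1 (fun y => 'D_v f y i' j')}.
  move=> y; rewrite inE => Uy; rewrite derive_entry //.
  by apply: differentiable_mx => k l; exact: (smooth_on_differentiable (sf k l)).
rewrite IH //; first by rewrite (iter_derive_ext s oU (vE i j)) // inE.
by move=> k l; apply: (smooth_on_ext oU (vE k l)); exact: smooth_on_derive.
Qed.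

Lemma smooth_on_entry {V : normedModType R} {m n} (U : set V) (f : V -> 'M[R]_(m, n)) i j :
  open U -> smooth_on U f -> smooth_on U (fun y => f y i j : R).
Proof.
move=> oU sf s.
suff E : forall x, U x -> iter_derive s (fun y => f y i j : R) x = iter_derive s f x i j.
  move=> x Ux.
  apply: (@near_eq_differentiable _ _ _ (fun y => iter_derive s f y i j : R)).
    have : nbhs x U by exact: open_nbhs_nbhs.
    by apply: filterS => y Uy; rewrite E.
  by apply: differentiable_entry; exact: sf.
elim: s f sf => [|v s IH] f sf x Ux //=.
rewrite -IH //; last exact: smooth_on_derive.
rewrite (@iter_derive_ext _ _ _ U s _ (fun y => 'D_v f y i j : R)) ?inE // => y.
rewrite inE => Uy; rewrite derive_entry //; exact: (smooth_on_differentiable sf).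
Qed.

Lemma smooth_on_coord m n (U : set 'M[R]_(m, n)) i j :
  open U -> smooth_on U (fun y => y i j : R).
Proof.
move=> oU [|v s] x Ux /=; first exact: differentiable_coord.
rewrite (_ : 'D_v _ = cst (v i j)).
  by apply: (smooth_on_cst _ oU).
apply: funext => y; rewrite -(derive_entry v i j (f := id)) ?derive_id //.
Qed.

(** The mean value theorem applied twice: in direction [v] to the [w]-increment of [f], then in
    direction [w] to ['D_v f]. The extra set [N] records where the intermediate point lies. *)
Lemma second_difference {V : normedModType R} (U N : set V) (f : V -> R) x v w h :
  0 < h -> open U -> smooth_on U f ->
  (forall s t, 0 <= s <= h -> 0 <= t <= h -> (U `&` N) (x + s *: v + t *: w)) ->
  exists2 y, N y & f (x + h *: v + h *: w) - f (x + h *: w) - (f (x + h *: v) - f x)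
    = h * h * 'D_w ('D_v f) y.
Proof.
move=> h0 oU sf inU.
have line (k : V -> R) (p u : V) (s : R) : differentiable k (p + s *: u) ->
    is_derive s 1 (fun r => k (p + r *: u)) ('D_u k (p + s *: u)).
  move=> /(@diff_derivable _ _ _ _ _ u) dk.
  have E : (fun h0 => h0^-1 *: (((fun r => k (p + r *: u)) \o shift s) (h0 *: 1) - k (p + s *: u))) =
     (fun h0 => h0^-1 *: ((k \o shift (p + s *: u)) (h0 *: u) - k (p + s *: u))).
    apply: funext => r /=; rewrite [r%:A]mulr1 scalerDl addrCA addrA.
    by congr (_ *: (k _ - _)); rewrite !addrA (addrC p).
  by split; rewrite /derivable /derive E.
have dU k (p : V) : U p -> smooth_on U k -> differentiable k p.
  by move=> Up sk; exact: (smooth_on_differentiable sk).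
have inUs s t : 0 <= s <= h -> 0 <= t <= h -> U (x + s *: v + t *: w).
  by move=> sh th; have [] := inU s t sh th.
have h0h : 0 <= h <= h by rewrite lexx ltW.
have zh : (0 : R) <= 0 <= h by rewrite lexx ltW.
have [s + sE] : exists2 s, s \in `]0, h[%R &
   (f (x + h *: v + h *: w) - f (x + h *: v)) - (f (x + 0 *: v + h *: w) - f (x + 0 *: v)) =
   ('D_v f (x + s *: v + h *: w) - 'D_v f (x + s *: v)) * (h - 0).
  pose k r := f (x + h *: w + r *: v) - f (x + r *: v).
  have dk r : 0 <= r <= h -> is_derive r 1 k
      ('D_v f (x + h *: w + r *: v) - 'D_v f (x + r *: v)).
    move=> rh; apply: is_deriveB; apply: line; apply: dU => //.
      by rewrite addrAC; exact: inUs.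
    by have := inUs r 0 rh zh; rewrite scale0r addr0.
  have := @MVT R k (fun r => 'D_v f (x + h *: w + r *: v) - 'D_v f (x + r *: v)) 0 h h0.
  case.
  - by move=> r; rewrite in_itv /= => /andP[r0 rh]; apply: dk; rewrite !ltW.
  - apply: derivable_within_continuous => r; rewrite in_itv /= => rh.
    exact: (@ex_derive _ _ _ _ _ _ _ (dk r rh)).
  - move=> s sh; rewrite /k !(addrAC x (h *: w)) => ->; exists s => //.
rewrite in_itv /= => /andP[s0 sh]; have shh : 0 <= s <= h by rewrite !ltW.
have dk r : 0 <= r <= h -> is_derive r 1 (fun r => 'D_v f (x + s *: v + r *: w))
    ('D_w ('D_v f) (x + s *: v + r *: w)).
  by move=> rh; apply: line; apply: dU; [exact: inUs | exact: smooth_on_derive].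
have [||t + tE] := @MVT R (fun r => 'D_v f (x + s *: v + r *: w))
   (fun r => 'D_w ('D_v f) (x + s *: v + r *: w)) 0 h h0.
- by move=> r; rewrite in_itv /= => /andP[r0 rh]; apply: dk; rewrite !ltW.
- apply: derivable_within_continuous => r; rewrite in_itv /= => rh.
  exact: (@ex_derive _ _ _ _ _ _ _ (dk r rh)).
rewrite in_itv /= => /andP[t0 th].
exists (x + s *: v + t *: w); first by have [] := inU s t shh _; rewrite ?ltW.
move: sE tE; rewrite !scale0r !addr0 subr0 => sE tE.
by rewrite addrAC opprB addrA addrAC -mulrA mulrC in sE *; rewrite tE in sE; lra.
Qed.

(** One second difference is [h * h] times either mixed derivative, each taken at some point near
    [x]. If the mixed derivatives differed at [x], continuity would keep each within half of the gap
    of its value at [x], which is contradictory. *)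
Lemma derive_sym {V : normedModType R} (U : set V) (f : V -> R) x v w :
  open U -> smooth_on U f -> U x -> 'D_w ('D_v f) x = 'D_v ('D_w f) x.
Proof.
move=> oU sf Ux; apply/eqP; apply: contraT => neq.
have cvw : {for x, continuous ('D_w ('D_v f))}.
  by apply: differentiable_continuous; exact: (sf [:: v; w]).
have cwv : {for x, continuous ('D_v ('D_w f))}.
  by apply: differentiable_continuous; exact: (sf [:: w; v]).
set e := `|'D_w ('D_v f) x - 'D_v ('D_w f) x| / 2.
have e0 : 0 < e by rewrite divr_gt0 // normr_gt0 subr_eq0.
pose N := [set y | `|'D_w ('D_v f) x - 'D_w ('D_v f) y| < e /\
                   `|'D_v ('D_w f) x - 'D_v ('D_w f) y| < e].
have Nx : nbhs x (U `&` N).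
  apply: filterI; first exact: open_nbhs_nbhs.
  by apply: filterI; [move/cvgrPdist_lt : cvw; exact | move/cvgrPdist_lt : cwv; exact].
have [h h0 hN] : exists2 h, 0 < h & forall s t, 0 <= s <= h -> 0 <= t <= h ->
    (U `&` N) (x + s *: v + t *: w).
  have /nbhs_ballP[d /= d0 dN] := Nx.
  (* The [+ 1] keeps the denominator positive when [v] and [w] vanish, and halving [d] makes the
     final bound strict. *)
  exists (d / 2 / (`|v| + `|w| + 1)).
    by rewrite !divr_gt0 // ltr_wpDl // addr_ge0.
  move=> s t /andP[s0 sh] /andP[t0 th]; apply: dN.
  rewrite -ball_normE /ball_ /= -addrA opprD addNKr normrN.
  rewrite (le_lt_trans (ler_normD _ _)) // !normrZ (ger0_norm s0) (ger0_norm t0).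
  apply: (@le_lt_trans _ _ (d / 2 / (`|v| + `|w| + 1) * (`|v| + `|w| + 1))).
    by rewrite 2!mulrDr -addrA lerD ?ler_wpM2r // ler_wpDr ?ler_wpM2r // mulr1 (le_trans s0).
  by rewrite divfK ?gt_eqF ?ltr_wpDl ?addr_ge0 // gtr_pMr // invf_lt1 // ltr1n.
have [y [Ny _] yE] := second_difference h0 oU sf hN.
have [|z [_ Nz] zE] := @second_difference _ U N f x w v h h0 oU sf.
  by move=> s t sh th; rewrite addrAC; exact: hN.
have hh : h * h != 0 by rewrite mulf_neq0 ?gt_eqF.
have yz : 'D_w ('D_v f) y = 'D_v ('D_w f) z.
  move: yE zE; rewrite (addrAC x (h *: w)).
  move: ('D_w _ y) ('D_v _ z) (f x) (f _) (f _) (f _) => p q r1 r2 r3 r4 E1 E2.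
  by apply: (mulfI hh); rewrite -E1 -E2; ring.
have : `|'D_w ('D_v f) x - 'D_v ('D_w f) x| < e + e.
  apply: (le_lt_trans (ler_distD ('D_w ('D_v f) y) _ _)); apply: ltrD.
    exact: Ny.
  by rewrite yz distrC; exact: Nz.
by rewrite /e -splitr ltxx.
Qed.

End SmoothMatrix.

(** * Lorentzian geometry *)

Section LorentzAlgebra.
Context {R : realType}.
Notation E := 'rV[R]_5.
Implicit Types (x y v w : E).

Lemma lorentzC x y : lorentz x y = lorentz y x.
Proof.
by rewrite /lorentz mulrC; congr (_ + _); apply: eq_bigr => i _; rewrite mulrC.
Qed.

Lemma lorentzDl x y z : lorentz (x + y) z = lorentz x z + lorentz y z.
Proof.
rewrite /lorentz !mxE mulrDl opprD addrACA -big_split; congr (_ + _).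
by apply: eq_bigr => i _; rewrite !mxE mulrDl.
Qed.

Lemma lorentzZl k x y : lorentz (k *: x) y = k * lorentz x y.
Proof.
rewrite /lorentz !mxE mulrDr mulrN mulrA mulr_sumr; congr (_ + _).
by apply: eq_bigr => i _; rewrite !mxE mulrA.
Qed.

Lemma lorentzDr x y z : lorentz x (y + z) = lorentz x y + lorentz x z.
Proof. by rewrite !(lorentzC x) lorentzDl. Qed.

Lemma lorentzZr k x y : lorentz x (k *: y) = k * lorentz x y.
Proof. by rewrite !(lorentzC x) lorentzZl. Qed.

Lemma lorentz0l x : lorentz 0 x = 0.
Proof. by rewrite -(scale0r (0 : E)) lorentzZl mul0r. Qed.

Lemma lorentz0r x : lorentz x 0 = 0.
Proof. by rewrite lorentzC lorentz0l. Qed.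

Lemma lorentzNl x y : lorentz (- x) y = - lorentz x y.
Proof. by rewrite -scaleN1r lorentzZl mulN1r. Qed.

Lemma lorentzNr x y : lorentz x (- y) = - lorentz x y.
Proof. by rewrite lorentzC lorentzNl lorentzC. Qed.

Lemma lorentz_suml (I : Type) (r : seq I) (P : pred I) (F : I -> E) y :
  lorentz (\sum_(i <- r | P i) F i) y = \sum_(i <- r | P i) lorentz (F i) y.
Proof.
elim/big_rec2: _ => [|i u z _ <-]; first by rewrite lorentz0l.
by rewrite lorentzDl.
Qed.

Definition lorentzE := (lorentzDl, lorentzDr, lorentzNl, lorentzNr, lorentzZl, lorentzZr).

Let sp (i : 'I_4) : 'I_5 := lift ord0 i.

Lemma lorentz_coords x y : lorentz x y = - (x 0 0 * y 0 0) +
  (x 0 (sp 0) * y 0 (sp 0) + (x 0 (sp 1) * y 0 (sp 1)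
   + (x 0 (sp 2) * y 0 (sp 2) + x 0 (sp 3) * y 0 (sp 3)))).
Proof.
rewrite /lorentz !big_ord_recl big_ord0 addr0.
by do !congr (_ + _); congr (x 0 _ * y 0 _); apply/val_inj.
Qed.

(** Lagrange's identity: with [x0^2 = 1 + |x'|^2] and [x0 v0 = x' . v'] for the spatial parts,
    [x0^2 <v, v>] is [|v'|^2] plus the squares of the 2 by 2 minors of [x'] and [v']. The spatial
    part [v'] is nonzero, since otherwise [x0 v0 = 0] would kill [v0] too. *)
Lemma H4_spacelike x v : H4 x -> lorentz x v = 0 -> v != 0 -> 0 < lorentz v v.
Proof.
case=> xx x0 xv v0.
have : exists i, v 0 (sp i) != 0.
  apply: contrapT => nv; case/negP: v0; apply/eqP/rowP => i.
  have vs j : v 0 (sp j) = 0.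
    by apply/eqP; apply: contraT => vj; case: nv; exists j.
  rewrite mxE; case: (unliftP ord0 i) => [j ->|->]; first exact: vs.
  move: xv; rewrite lorentz_coords !vs !mulr0 !addr0 => /eqP.
  by rewrite oppr_eq0 mulf_eq0 gt_eqF //= => /eqP.
have -> : (exists i, v 0 (sp i) != 0) <->
    0 < v 0 (sp 0) ^+ 2 + (v 0 (sp 1) ^+ 2 + (v 0 (sp 2) ^+ 2 + v 0 (sp 3) ^+ 2)).
  split=> [[i vi]|]; last first.
    rewrite ltNge => /negP s; apply: contrapT => nv; apply: s.
    have vs j : v 0 (sp j) = 0.
      by apply/eqP; apply: contraT => vj; case: nv; exists j.
    by rewrite !vs !expr0n /= !addr0.
  have vi2 : 0 < v 0 (sp i) ^+ 2 by rewrite lt0r expf_neq0 ?sqr_ge0.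
  have -> : v 0 (sp 0) ^+ 2 + (v 0 (sp 1) ^+ 2 + (v 0 (sp 2) ^+ 2 + v 0 (sp 3) ^+ 2)) =
     \sum_i v 0 (sp i) ^+ 2.
    rewrite !big_ord_recl big_ord0 addr0.
    by do !congr (_ + _); congr (v 0 _ ^+ _); apply/val_inj.
  by rewrite (bigD1 i) //= ltr_pwDl // sumr_ge0 // => j _; rewrite sqr_ge0.
move: xx xv; rewrite !lorentz_coords.
set X0 := x 0 0; set V0 := v 0 0.
set X1 := x 0 (sp 0); set X2 := x 0 (sp 1); set X3 := x 0 (sp 2); set X4 := x 0 (sp 3).
set V1 := v 0 (sp 0); set V2 := v 0 (sp 1); set V3 := v 0 (sp 2); set V4 := v 0 (sp 3).
move=> xx xv vpos.
have : 0 < X0 ^+ 2 * (- (V0 * V0) + (V1 * V1 + (V2 * V2 + (V3 * V3 + V4 * V4)))).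
  have -> : X0 ^+ 2 * (- (V0 * V0) + (V1 * V1 + (V2 * V2 + (V3 * V3 + V4 * V4)))) =
    (V1 ^+ 2 + (V2 ^+ 2 + (V3 ^+ 2 + V4 ^+ 2))) +
    ((X1 * V2 - X2 * V1) ^+ 2 + (X1 * V3 - X3 * V1) ^+ 2 + (X1 * V4 - X4 * V1) ^+ 2
    + (X2 * V3 - X3 * V2) ^+ 2 + (X2 * V4 - X4 * V2) ^+ 2 + (X3 * V4 - X4 * V3) ^+ 2).
    have e1 : X0 ^+ 2 = 1 + (X1 * X1 + (X2 * X2 + (X3 * X3 + X4 * X4))) by lra.
    have e2 : X0 * V0 = X1 * V1 + (X2 * V2 + (X3 * V3 + X4 * V4)) by lra.
    have -> : X0 ^+ 2 * (- (V0 * V0) + (V1 * V1 + (V2 * V2 + (V3 * V3 + V4 * V4)))) =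
      - (X0 * V0) ^+ 2 + X0 ^+ 2 * (V1 * V1 + (V2 * V2 + (V3 * V3 + V4 * V4))) by ring.
    by rewrite e2 e1; ring.
  by rewrite ltr_pwDl // !addr_ge0 // sqr_ge0.
by rewrite pmulr_rgt0 // exprn_gt0.
Qed.

Lemma H4_spacelike_eq0 x v : H4 x -> lorentz x v = 0 -> lorentz v v = 0 -> v = 0.
Proof.
move=> hx xv vv; apply/eqP; apply: contraT => v0.
by have := H4_spacelike hx xv v0; rewrite vv ltxx.
Qed.

Lemma cosh_sqr (t : R) : cosh t ^+ 2 = 1 + sinh t ^+ 2.
Proof.
have := expRxMexpNx_1 t; rewrite /cosh /sinh; set u := expR t; set w := expR (- t) => uw.
have : ((u + w) / 2) ^+ 2 - ((u - w) / 2) ^+ 2 = u * w by field.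
by rewrite uw => /eqP; rewrite subr_eq => /eqP.
Qed.

(** Twice this is [(1 + k) e^t + (1 - k) e^-t], with nonnegative coefficients that do not both
    vanish. *)
Lemma cosh_sinh (t k : R) : k ^+ 2 <= 1 -> 0 < cosh t + k * sinh t.
Proof.
move=> k1; rewrite /cosh /sinh.
have := expR_gt0 t; have := expR_gt0 (- t).
set u := expR t; set w := expR (- t) => w0 u0.
have /andP[k1' k2'] : -1 <= k <= 1.
  by rewrite -ler_norml -(@ler_sqr _ `|k|) ?nnegrE // real_normK ?num_real // expr1n.
nra.
Qed.

(** The sheet [x0 > 0] is not left: Cauchy-Schwarz on the spatial parts gives [v0^2 <= x0^2], so the
    time coordinate is [x0 (cosh t + k sinh t)] with [k^2 <= 1]. *)
Lemma H4_combination x v t : H4 x -> lorentz x v = 0 -> lorentz v v = 1 ->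
  H4 (cosh t *: x + sinh t *: v).
Proof.
move=> hx xv vv; have [xx x0] := hx; split.
  rewrite !lorentzE (lorentzC v x) xx xv vv.
  have := cosh_sqr t; set c := cosh t; set s := sinh t => cs; nra.
rewrite !mxE.
have := xx; have := xv; have := vv; rewrite !lorentz_coords.
set X0 := x 0 0; set V0 := v 0 0.
set X1 := x 0 (sp 0); set X2 := x 0 (sp 1); set X3 := x 0 (sp 2); set X4 := x 0 (sp 3).
set V1 := v 0 (sp 0); set V2 := v 0 (sp 1); set V3 := v 0 (sp 2); set V4 := v 0 (sp 3).
move=> ev exv ex.
have : V0 ^+ 2 <= X0 ^+ 2.
  have e1 : X1 * X1 + (X2 * X2 + (X3 * X3 + X4 * X4)) = X0 ^+ 2 - 1 by lra.
  have e2 : X1 * V1 + (X2 * V2 + (X3 * V3 + X4 * V4)) = X0 * V0 by lra.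
  have e3 : V1 * V1 + (V2 * V2 + (V3 * V3 + V4 * V4)) = 1 + V0 ^+ 2 by lra.
  have cs : (X1 * V1 + (X2 * V2 + (X3 * V3 + X4 * V4))) ^+ 2 <=
     (X1 * X1 + (X2 * X2 + (X3 * X3 + X4 * X4))) *
     (V1 * V1 + (V2 * V2 + (V3 * V3 + V4 * V4))).
    rewrite -subr_ge0.
    have -> : (X1 * X1 + (X2 * X2 + (X3 * X3 + X4 * X4))) *
     (V1 * V1 + (V2 * V2 + (V3 * V3 + V4 * V4))) -
      (X1 * V1 + (X2 * V2 + (X3 * V3 + X4 * V4))) ^+ 2 =
    ((X1 * V2 - X2 * V1) ^+ 2 + (X1 * V3 - X3 * V1) ^+ 2 + (X1 * V4 - X4 * V1) ^+ 2
    + (X2 * V3 - X3 * V2) ^+ 2 + (X2 * V4 - X4 * V2) ^+ 2 + (X3 * V4 - X4 * V3) ^+ 2)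
      by ring.
    by rewrite !addr_ge0 // sqr_ge0.
  by rewrite e1 e2 e3 in cs; lra.
move=> VX; have k1 : (V0 / X0) ^+ 2 <= 1.
  by rewrite expr_div_n ler_pdivrMr ?exprn_gt0 // mul1r.
have -> : cosh t * X0 + sinh t * V0 = X0 * (cosh t + V0 / X0 * sinh t).
  by field; rewrite gt_eqF.
by rewrite mulr_gt0 // cosh_sinh.
Qed.

End LorentzAlgebra.

Section LorentzCalculus.
Context {R : realType}.
Notation E := 'rV[R]_5.

Lemma is_derive_lorentz {V : normedModType R} (f g : V -> E) x v :
  differentiable f x -> differentiable g x ->
  is_derive x v (fun y => lorentz (f y) (g y) : R)
    (lorentz ('D_v f x) (g x) + lorentz (f x) ('D_v g x)).
Proof.
move=> df dg.
have fgE k : is_derive x v (fun y => f y 0 k * g y 0 k : R)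
   ('D_v f x 0 k * g x 0 k + f x 0 k * 'D_v g x 0 k).
  have dfk : is_derive x v (fun y => f y 0 k : R) ('D_v f x 0 k).
    by rewrite derive_entry //; apply/derivableP/diff_derivable/differentiable_entry.
  have dgk : is_derive x v (fun y => g y 0 k : R) ('D_v g x 0 k).
    by rewrite derive_entry //; apply/derivableP/diff_derivable/differentiable_entry.
  apply: (is_derive_eq (is_deriveM dfk dgk)).
  by rewrite addrC; congr (_ + _); rewrite [LHS]mulrC.
rewrite (_ : (fun y => lorentz (f y) (g y)) =
   (- (fun y => f y 0 0 * g y 0 0 : R)) +
   \sum_(i < 4) (fun y => f y 0 (lift ord0 i) * g y 0 (lift ord0 i) : R)); last first.
  by apply: funext => y; rewrite fctE fct_sumE.
apply: is_derive_eq.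
by rewrite /lorentz big_split /= opprD addrACA.
Qed.

Lemma differentiable_lorentz {V : normedModType R} (f g : V -> E) x :
  differentiable f x -> differentiable g x ->
  differentiable (fun y => lorentz (f y) (g y) : R) x.
Proof.
move=> df dg.
rewrite (_ : (fun y => lorentz (f y) (g y)) =
   (- (fun y => f y 0 0 * g y 0 0 : R)) +
   \sum_(i < 4) (fun y => f y 0 (lift ord0 i) * g y 0 (lift ord0 i) : R)); last first.
  by apply: funext => y; rewrite fctE fct_sumE.
have dfg k : differentiable (fun y => f y 0 k * g y 0 k : R) x.
  by apply: differentiableM; exact: differentiable_entry.
by apply: differentiableD; [exact: differentiableN | exact: differentiable_sum].
Qed.

Lemma smooth_on_lorentz {V : normedModType R} (U : set V) (f g : V -> E) :
  open U -> smooth_on U f -> smooth_on U g ->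
  smooth_on U (fun y => lorentz (f y) (g y) : R).
Proof.
move=> oU sf sg.
have sfg k : smooth_on U (fun y => f y 0 k * g y 0 k : R).
  by apply: smooth_onM => //; exact: smooth_on_entry.
apply: (@smooth_on_ext _ _ _ U (fun y => cst (-1) y * (f y 0 0 * g y 0 0) +
    \sum_(i < 4) (f y 0 (lift ord0 i) * g y 0 (lift ord0 i)))) => //.
  by move=> y _; rewrite /lorentz mulN1r.
apply: smooth_onD => //; last exact: smooth_on_sum.
by apply: smooth_onM => //; exact: smooth_on_cst.
Qed.

Lemma smooth_on_prod {V : normedModType R} (I : Type) (r : seq I) (U : set V)
    (F : I -> V -> R) : open U ->
  (forall i, smooth_on U (F i)) -> smooth_on U (fun x => \prod_(i <- r) F i x).
Proof.
move=> oU sF; elim: r => [|i r IH].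
  apply: (@smooth_on_ext _ _ R _ (cst (1 : R))) => //; last exact: smooth_on_cst.
  by move=> x _; rewrite big_nil.
apply: (@smooth_on_ext _ _ R _ (fun x => F i x * \prod_(j <- r) F j x)) => //.
  by move=> x _; rewrite big_cons.
exact: smooth_onM.
Qed.

Lemma smooth_on_det {V : normedModType R} n (U : set V) (G : V -> 'M[R]_n) :
  open U -> (forall i j, smooth_on U (fun y => G y i j : R)) ->
  smooth_on U (fun y => \det (G y) : R).
Proof.
move=> oU sG; rewrite /determinant; apply: smooth_on_sum => // s.
apply: smooth_onM => //; first exact: smooth_on_cst.
by apply: smooth_on_prod.
Qed.

(** Cramer's rule: an entry of the inverse is a signed minor divided by the determinant. *)
Lemma smooth_on_invmx {V : normedModType R} n (U : set V) (G : V -> 'M[R]_n) i j :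
  open U -> (forall x, U x -> G x \in unitmx) ->
  (forall i j, smooth_on U (fun y => G y i j : R)) ->
  smooth_on U (fun y => invmx (G y) i j : R).
Proof.
move=> oU uG sG.
apply: (@smooth_on_ext _ _ R _ (fun y => (\det (G y))^-1 *
   (cst ((-1) ^+ (j + i)) y * \det (row' j (col' i (G y)))))) => //.
  by move=> y; rewrite inE => Uy; rewrite /invmx uG // !mxE /cofactor.
apply: smooth_onM => //.
  apply: smooth_onV => //; last exact: smooth_on_det.
  by move=> x Ux; have := uG x Ux; rewrite unitmxE unitfE.
apply: smooth_onM => //; first exact: smooth_on_cst.
apply: smooth_on_det => // k l.
apply: (@smooth_on_ext _ _ R _ (fun y => G y (lift j k) (lift i l))) => //.
by move=> y _; rewrite !mxE.
Qed.

End LorentzCalculus.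

(** * Bilinear forms and Gram matrices *)

Section Forms.
Context {R : realType}.

Lemma bilinE n (G : 'M[R]_n) v w :
  bilin G v w = \sum_i \sum_j v 0 i * G i j * w 0 j.
Proof.
rewrite /bilin mxE exchange_big; apply: eq_bigr => j _.
by rewrite !mxE mulr_suml; apply: eq_bigr => i _; rewrite mulrC.
Qed.

Lemma bilinDl n (G : 'M[R]_n) u v w : bilin G (u + v) w = bilin G u w + bilin G v w.
Proof. by rewrite /bilin !mulmxDl mxE. Qed.

Lemma bilinZl n (G : 'M[R]_n) k v w : bilin G (k *: v) w = k * bilin G v w.
Proof. by rewrite /bilin -!scalemxAl mxE. Qed.

Lemma bilinDr n (G : 'M[R]_n) u v w : bilin G u (v + w) = bilin G u v + bilin G u w.
Proof. by rewrite /bilin linearD mulmxDr mxE. Qed.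

Lemma bilinZr n (G : 'M[R]_n) k v w : bilin G v (k *: w) = k * bilin G v w.
Proof. by rewrite /bilin linearZ -scalemxAr mxE. Qed.

Lemma bilinC n (G : 'M[R]_n) v w : G^T = G -> bilin G v w = bilin G w v.
Proof.
move=> GT; rewrite /bilin (_ : v *m G *m w^T = (w *m G *m v^T)^T) ?mxE //.
by rewrite !trmx_mul trmxK GT mulmxA.
Qed.

Definition posdef n (G : 'M[R]_n) := forall v, v != 0 -> 0 < bilin G v v.

Lemma posdef_unitmx n (G : 'M[R]_n) : posdef G -> G \in unitmx.
Proof.
move=> pG; rewrite -row_free_unit; apply: inj_row_free => v vG.
apply/eqP; apply: contraT => /pG; rewrite /bilin vG mul0mx mxE ltxx //.
Qed.

Lemma posdef_ge0 n (G : 'M[R]_n) v : posdef G -> 0 <= bilin G v v.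
Proof.
move=> pG; have [->|/pG/ltW //] := eqVneq v 0.
by rewrite /bilin !mul0mx mxE.
Qed.

Lemma row_free_pair n (v w : 'rV[R]_n) k l :
  row_free (col_mx v w) -> k *: v + l *: w = 0 -> k = 0 /\ l = 0.
Proof.
move=> vw kl; have /eqP : row_mx k%:M l%:M *m col_mx v w = 0.
  by rewrite mul_row_col !mul_scalar_mx.
rewrite mulmx_free_eq0 // => /eqP/rowP kl0; split.
  by have := kl0 (lshift 1 0); rewrite row_mxEl !mxE /= mulr1n.
by have := kl0 (rshift 1 0); rewrite row_mxEr !mxE /= mulr1n.
Qed.

(** Subtract from [v] its projection on [w]: the remainder is nonzero, and its squared length is
    this Gram determinant divided by [bilin G w w]. *)
Lemma posdef_cauchy n (G : 'M[R]_n) v w : G^T = G -> posdef G ->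
  row_free (col_mx v w) ->
  0 < bilin G v v * bilin G w w - bilin G v w ^+ 2.
Proof.
move=> GT pG vw.
have w0 : w != 0.
  apply/eqP => w0; have [] := @row_free_pair _ v w 0 1 vw.
    by rewrite w0 scaler0 scale0r addr0.
  by move=> _ /eqP; rewrite oner_eq0.
have ww := pG _ w0.
have : v - (bilin G v w / bilin G w w) *: w != 0.
  apply/eqP => e; have [] := @row_free_pair _ v w 1 (- (bilin G v w / bilin G w w)) vw.
    by rewrite scale1r scaleNr.
  by move=> /eqP; rewrite oner_eq0.
move=> /pG; rewrite -scaleNr !(bilinDl, bilinDr, bilinZl, bilinZr) (bilinC w v GT).
move: (bilin G v v) (bilin G v w) (bilin G w w) ww => A B C C0.
have -> : A + - (B / C) * B + (- (B / C) * B + - (B / C) * (- (B / C) * C)) =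
   (A * C - B ^+ 2) / C by field; rewrite gt_eqF.
by rewrite pmulr_lgt0 // invr_gt0.
Qed.

Lemma diff_partial {W : normedModType R} n (f : 'rV[R]_n -> W) x (v : 'rV[R]_n) :
  differentiable f x -> 'd f x v = \sum_i v 0 i *: partial i f x.
Proof.
move=> df; rewrite {1}(row_sum_delta v) linear_sum; apply: eq_bigr => i _.
by rewrite linearZ /= /partial deriveE.
Qed.

End Forms.

(* Comparing [partial i f] and [partial j f] by conversion unfolds limits and is prohibitively
   slow; [pd] is [partial] with a locked body. *)
Fact pd_key : unit. Proof. exact: tt. Qed.
Definition pd {R : realType} {n} (i : 'I_n) (f : 'rV[R]_n -> 'rV[R]_5) : 'rV[R]_n -> 'rV[R]_5 :=
  locked_with pd_key (@partial R n 'rV[R]_5) i f.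

Section PartialDerivatives.
Context {R : realType} {n : nat}.
Notation E := 'rV[R]_5.
Implicit Types (f : 'rV[R]_n -> E).

Lemma pdE i f : pd i f = partial i f.
Proof. by rewrite /pd unlock. Qed.

Lemma gramE f x i j : gram f x i j = lorentz (pd i f x) (pd j f x).
Proof. by rewrite mxE !pdE. Qed.

Lemma diff_pd f x (v : 'rV[R]_n) :
  differentiable f x -> 'd f x v = \sum_i v 0 i *: pd i f x.
Proof. by move=> df; rewrite diff_partial //; apply: eq_bigr => i _; rewrite pdE. Qed.

Lemma bilin_gram f x v w : differentiable f x ->
  bilin (gram f x) v w = lorentz ('d f x v) ('d f x w).
Proof.
move=> df; rewrite bilinE !diff_pd // lorentz_suml; apply: eq_bigr => i _.
rewrite lorentzZl lorentzC lorentz_suml mulr_sumr; apply: eq_bigr => j _.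
rewrite lorentzZl gramE (lorentzC (pd j f x)) -mulrA; congr (_ * _); exact: mulrC.
Qed.

Lemma gram_sym f x : (gram f x)^T = gram f x.
Proof. by apply/matrixP => i j; rewrite mxE !gramE lorentzC. Qed.

Lemma smooth_on_pd (U : set 'rV[R]_n) f i : smooth_on U f -> smooth_on U (pd i f).
Proof. by rewrite pdE; exact: smooth_on_derive. Qed.

Lemma partial_lorentz f g i x : differentiable f x -> differentiable g x ->
  partial i (fun y => lorentz (f y) (g y) : R) x =
  lorentz (pd i f x) (g x) + lorentz (f x) (pd i g x).
Proof. by move=> df dg; rewrite !pdE; apply: derive_val; exact: is_derive_lorentz. Qed.

Lemma pd_cst (c : E) i x : pd i (cst c : 'rV[R]_n -> E) x = 0.
Proof. by rewrite pdE /partial derive_cst. Qed.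

Lemma pd_sym (U : set 'rV[R]_n) f i j x :
  open U -> smooth_on U f -> U x -> pd i (pd j f) x = pd j (pd i f) x.
Proof.
move=> oU sf Ux; apply/rowP => k.
have E1 v w : 'D_v ('D_w f) x 0 k = 'D_v ('D_w (fun y => f y 0 k : R)) x.
  rewrite derive_entry; last exact: (smooth_on_differentiable (smooth_on_derive _ sf)).
  apply: near_eq_derive; have : nbhs x U by exact: open_nbhs_nbhs.
  by apply: filterS => y Wy; rewrite derive_entry //; exact: (smooth_on_differentiable sf).
rewrite !pdE; apply: (etrans (E1 _ _)); apply: (etrans _ (esym (E1 _ _))).
by apply: (derive_sym _ _ oU (smooth_on_entry 0 k oU sf)).
Qed.

Lemma partial_eq_on (U : set 'rV[R]_n) (f g : 'rV[R]_n -> R) i x :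
  open U -> (forall y, U y -> f y = g y) -> U x -> partial i f x = partial i g x.
Proof.
move=> oU fg Ux; apply: near_eq_derive.
have : nbhs x U by exact: open_nbhs_nbhs.
by apply: filterS => y Uy; rewrite fg.
Qed.

Lemma pd_eq_on (U : set 'rV[R]_n) f g i x :
  open U -> (forall y, U y -> f y = g y) -> U x -> pd i f x = pd i g x.
Proof.
move=> oU fg Ux; rewrite !pdE; apply: near_eq_derive.
have : nbhs x U by exact: open_nbhs_nbhs.
by apply: filterS => y Uy; rewrite fg.
Qed.

End PartialDerivatives.

(** * Curvature of umbilical hypersurfaces *)

Section UmbilicalTangent.
Context {R : realType} {n : nat}.
Notation E := 'rV[R]_5.
Variables (a : E) (b : R) (U : set 'rV[R]_n) (f : 'rV[R]_n -> E).
Hypotheses (oU : open U) (df : forall x, U x -> differentiable f x).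
Hypothesis fQ : forall x, U x -> umbilical a b (f x).

Lemma umbilical_pd_position i x : U x -> lorentz (pd i f x) (f x) = 0.
Proof.
move=> Ux; have := @partial_lorentz _ _ f f i x (df Ux) (df Ux).
rewrite (@partial_eq_on _ _ U _ (cst (-1 : R)) i x) //; last by move=> y /fQ[[]].
rewrite {1}/partial derive_cst (lorentzC (f x)) -mulr2n => /esym/eqP.
by rewrite mulrn_eq0 /= => /eqP.
Qed.

Lemma umbilical_pd_axis i x : U x -> lorentz (pd i f x) a = 0.
Proof.
move=> Ux; have := @partial_lorentz _ _ f (cst a) i x (df Ux) (differentiable_cst _ _).
rewrite (@partial_eq_on _ _ U _ (cst (b : R)) i x) //; last first.
  by move=> y /fQ[_ /= hy]; rewrite lorentzC.
by rewrite {1}/partial derive_cst pd_cst lorentz0r addr0 => /esym.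
Qed.

End UmbilicalTangent.

Section UmbilicalCurvature.
Context {R : realType}.
Notation E := 'rV[R]_5.
Variables (a : E) (b : R).
Hypothesis hQ : umbilical_hypersurface a b.

(** At a point [x] of the hypersurface, [a + b x] is tangent to H^4 with this squared length;
    transversality makes it nonzero, hence spacelike. *)
Lemma umbilical_discr_gt0 : 0 < lorentz a a + b ^+ 2.
Proof.
have [_ [x Qx] fr] := hQ; have [hx ax] := Qx; have [xx x0] := hx.
have n0 : a + b *: x != 0.
  apply/eqP => e; have [] := @row_free_pair _ _ x a b 1 (fr x Qx).
    by rewrite scale1r addrC.
  by move=> _ /eqP; rewrite oner_eq0.
have xn : lorentz x (a + b *: x) = 0 by rewrite !lorentzE (lorentzC x a) ax xx; ring.
have := H4_spacelike hx xn n0.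
suff -> : lorentz (a + b *: x) (a + b *: x) = lorentz a a + b ^+ 2 by [].
by rewrite !lorentzE (lorentzC x a) ax xx; ring.
Qed.

(** This is [-1 + k^2], where [k^2 = b^2 / (<a, a> + b^2)] is the squared principal curvature of the
    hypersurface in H^4. *)
Definition umbilical_curvature : R := - lorentz a a / (lorentz a a + b ^+ 2).

Variables (U : set 'rV[R]_3) (phi : 'rV[R]_3 -> E).
Hypotheses (oU : open U) (sphi : smooth_on U phi).
Hypothesis phiQ : forall x, U x -> umbilical a b (phi x) /\ injective ('d phi x).

Let K := umbilical_curvature.
Let G := gram phi.
Let X i := pd i phi.
Let S i j := pd i (pd j phi).
(** The vector of the span of the position and [a] whose products with them are -1 and 0, as the
    second derivatives of [phi] require once divided by [G]. Being affine in the position, it has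
    derivative [- K] times that of [phi]. *)
Let nu y : E := - K *: phi y - (b / (lorentz a a + b ^+ 2)) *: a.

Let D0 : lorentz a a + b ^+ 2 != 0. Proof. by rewrite gt_eqF // umbilical_discr_gt0. Qed.

Let dphi x : U x -> differentiable phi x.
Proof. exact: smooth_on_differentiable. Qed.

Let sX i : smooth_on U (X i). Proof. exact: smooth_on_pd. Qed.
Let sS i j : smooth_on U (S i j). Proof. exact/smooth_on_pd/smooth_on_pd. Qed.

Let phi_umbilical x : U x -> umbilical a b (phi x).
Proof. by case/phiQ. Qed.

Let umbilical_tangent_position i x : U x -> lorentz (X i x) (phi x) = 0.
Proof. exact: (umbilical_pd_position oU dphi phi_umbilical). Qed.

Let umbilical_tangent_axis i x : U x -> lorentz (X i x) a = 0.
Proof. exact: (umbilical_pd_axis oU dphi phi_umbilical). Qed.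

Lemma umbilical_second_position i j x : U x -> lorentz (S i j x) (phi x) = - G x i j.
Proof.
move=> Ux.
have := @partial_lorentz _ _ (X j) phi i x (smooth_on_differentiable (sX j) Ux) (dphi Ux).
rewrite (@partial_eq_on _ _ U _ (cst (0 : R)) i x) //; last first.
  by move=> y Uy; exact: umbilical_tangent_position.
rewrite {1}/partial derive_cst => /esym/eqP; rewrite addr_eq0 => /eqP ->.
by rewrite /G gramE lorentzC.
Qed.

Lemma umbilical_second_axis i j x : U x -> lorentz (S i j x) a = 0.
Proof.
move=> Ux.
have := @partial_lorentz _ _ (X j) (cst a) i x
  (smooth_on_differentiable (sX j) Ux) (differentiable_cst _ _).
rewrite (@partial_eq_on _ _ U _ (cst (0 : R)) i x) //; last first.
  by move=> y Uy; exact: umbilical_tangent_axis.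
by rewrite {1}/partial derive_cst pd_cst lorentz0r addr0 => /esym.
Qed.

Lemma umbilical_gram_posdef x : U x -> posdef (G x).
Proof.
move=> Ux v v0; rewrite bilin_gram; last exact: dphi.
have [[hx _] inj] := phiQ Ux.
apply: (H4_spacelike hx).
  rewrite diff_pd; last exact: dphi.
  rewrite lorentzC lorentz_suml big1 // => i _.
  by rewrite lorentzZl umbilical_tangent_position // mulr0.
apply: contra_neq v0 => e; apply: inj; rewrite e.
by rewrite linear0.
Qed.

Lemma umbilical_gram_unit x : U x -> G x \in unitmx.
Proof. by move=> Ux; exact/posdef_unitmx/umbilical_gram_posdef. Qed.

Lemma smooth_gram i j : smooth_on U (fun y => G y i j : R).
Proof.
apply: (@smooth_on_ext _ _ R _ (fun y => lorentz (X i y) (X j y))) => //.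
  by move=> y _; rewrite /G gramE.
exact: smooth_on_lorentz.
Qed.

Lemma partial_gram i j l x : U x ->
  partial i (fun y => G y j l : R) x = lorentz (S i j x) (X l x) + lorentz (X j x) (S i l x).
Proof.
move=> Ux; rewrite -[RHS]partial_lorentz; last 2 first.
- exact: (smooth_on_differentiable (sX j)).
- exact: (smooth_on_differentiable (sX l)).
by apply: (partial_eq_on _ oU) => // y _; rewrite /G gramE.
Qed.

(** Each derivative of the metric splits into two products [<S, X>]; by symmetry of [S] the
    alternating sum cancels down to twice [<S_ij, X_l>]. *)
Lemma christoffel_lorentz i j k x : U x -> christoffel G i j k x =
  \sum_l invmx (G x) k l * lorentz (S i j x) (X l x).
Proof.
move=> Ux; rewrite /christoffel mulr_sumr; apply: eq_bigr => l _.
rewrite !partial_gram // mulrCA; congr (_ * _).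
have Ssym p q : S p q x = S q p x by exact: (pd_sym _ _ oU).
move: (Ssym j i) (Ssym l i) (Ssym l j).
move: (S j i x) (S i j x) (S l i x) (S i l x) (S l j x) (S j l x) (X i x) (X j x) (X l x).
move=> ji ij li il lj jl xi xj xl -> -> ->; rewrite (lorentzC xi) (lorentzC xj).
move: (lorentz ij xl) (lorentz il xj) (lorentz jl xi) => A B C.
by field.
Qed.

Lemma christoffel_gram i j p x : U x ->
  \sum_k christoffel G i j k x * G x k p = lorentz (S i j x) (X p x).
Proof.
move=> Ux.
under eq_bigr do rewrite christoffel_lorentz // mulr_suml.
transitivity (\sum_l (G x *m invmx (G x)) p l * lorentz (S i j x) (X l x)).
  rewrite exchange_big; apply: eq_bigr => l _; rewrite mxE mulr_suml.
  apply: eq_bigr => k _; rewrite mulrAC; congr (_ * _); rewrite mulrC; congr (_ * _).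
  by rewrite /G !gramE lorentzC.
rewrite mulmxV ?umbilical_gram_unit // (bigD1 p) //= big1 ?addr0 => [|l lp].
  by rewrite mxE eqxx mul1r.
by rewrite mxE eq_sym (negPf lp) mul0r.
Qed.

Lemma smooth_christoffel i j k : smooth_on U (christoffel G i j k).
Proof.
apply: (@smooth_on_ext _ _ R _ (fun x => \sum_l invmx (G x) k l * lorentz (S i j x) (X l x))) => //.
  by move=> y; rewrite inE => Uy; rewrite christoffel_lorentz.
apply: smooth_on_sum => // l; apply: smooth_onM => //; last exact: smooth_on_lorentz.
by apply: smooth_on_invmx => //; [exact: umbilical_gram_unit | exact: smooth_gram].
Qed.

(** The position, [a] and the three tangent vectors form a basis of R^5. A vector orthogonal to all
    of them is orthogonal to itself, and orthogonality to the position excludes nonzero null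
    vectors. *)
Lemma umbilical_frame_nondegenerate x w : U x -> lorentz w (phi x) = 0 ->
  lorentz w a = 0 -> (forall i, lorentz w (X i x) = 0) -> w = 0.
Proof.
move=> Ux wphi wa wX; have [[hx ax] _] := phiQ Ux.
pose T : 'M[R]_(3, 5) := \matrix_i X i x.
pose F : 'M[R]_(1 + 1 + 3, 5) := col_mx (col_mx (phi x) a) T.
have rowF (u : 'rV[R]_(1 + 1 + 3)) (z : E) : lorentz (u *m F) z =
    u 0 (lshift 3 (lshift 1 0)) * lorentz (phi x) z
    + u 0 (lshift 3 (rshift 1 0)) * lorentz a z
    + \sum_i u 0 (rshift _ i) * lorentz (X i x) z.
  rewrite mulmx_sum_row lorentz_suml !big_split_ord /= !big_ord1.
  congr (_ + _ + _).
  - by rewrite lorentzZl /F rowKu rowKu row_id.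
  - by rewrite lorentzZl /F rowKu rowKd row_id.
  - by apply: eq_bigr => i _; rewrite lorentzZl /F rowKd rowK.
have Ffull : row_full F.
  suff : row_free F by [].
  apply: inj_row_free => u uF.
  (* Pairing a vanishing combination with the tangent vectors leaves the tangential coefficients
     times the invertible Gram matrix. *)
  have u3 : rsubmx u = 0.
    have GU : G x \in unitmx by exact: umbilical_gram_unit.
    have : rsubmx u *m G x = 0.
      apply/rowP => j; rewrite mxE mxE.
      have := rowF u (X j x); rewrite uF lorentz0l (lorentzC (phi x)) (lorentzC a).
      rewrite umbilical_tangent_position // umbilical_tangent_axis // !mulr0 !add0r => u0.
      by rewrite [RHS]u0; apply: eq_bigr => i _; rewrite mxE /G gramE.
    by move/(congr1 (mulmx^~ (invmx (G x)))); rewrite /= mulmxK // mul0mx.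
  (* What remains is a linear relation between the position and [a], excluded by transversality. *)
  have [||u1 u2] := @row_free_pair _ _ (phi x) a (u 0 (lshift 3 (lshift 1 0)))
      (u 0 (lshift 3 (rshift 1 0))).
    by case: hQ => _ _; apply; have [] := phiQ Ux.
    have := uF; rewrite -{1}(hsubmxK u) u3 /F mul_row_col mul0mx addr0.
    rewrite -{1}(hsubmxK (lsubmx u)) mul_row_col.
    rewrite [lsubmx (lsubmx u)]mx11_scalar [rsubmx (lsubmx u)]mx11_scalar !mul_scalar_mx.
    by rewrite !mxE.
  rewrite -(hsubmxK u) u3 -(hsubmxK (lsubmx u)).
  rewrite [lsubmx (lsubmx u)]mx11_scalar [rsubmx (lsubmx u)]mx11_scalar !mxE u1 u2.
  by rewrite raddf0 !row_mx0.
have [u wE] := submxP (submx_full w Ffull).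
apply: (H4_spacelike_eq0 hx); first by rewrite lorentzC.
rewrite {1}wE rowF !(lorentzC _ w) wphi wa !mulr0 !add0r big1 // => i _.
by rewrite lorentzC wX mulr0.
Qed.

(* Gauss formula: the umbilical normal part of the second derivatives is [G i j] times a fixed
   affine function of the position. *)
Lemma umbilical_gauss_formula i j x : U x ->
  S i j x = \sum_k christoffel G i j k x *: X k x + G x i j *: nu x.
Proof.
move=> Ux; have [[hx ax] _] := phiQ Ux; have [xx _] := hx.
apply/eqP; rewrite -subr_eq0; apply/eqP.
apply: (umbilical_frame_nondegenerate Ux).
- rewrite lorentzDl lorentzNl lorentzDl lorentz_suml big1 => [|k _]; last first.
    by rewrite lorentzZl umbilical_tangent_position // mulr0.
  rewrite umbilical_second_position // /nu !lorentzE xx ax /K /umbilical_curvature.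
  by field; exact: D0.
- rewrite lorentzDl lorentzNl lorentzDl lorentz_suml big1 => [|k _]; last first.
    by rewrite lorentzZl umbilical_tangent_axis // mulr0.
  rewrite umbilical_second_axis // /nu !lorentzE (lorentzC (phi x)) ax /K /umbilical_curvature.
  by field; exact: D0.
- move=> l; rewrite lorentzDl lorentzNl lorentzDl lorentz_suml.
  rewrite -(christoffel_gram i j l Ux) lorentzZl /nu !lorentzE.
  rewrite !(lorentzC _ (X l x)) umbilical_tangent_position // umbilical_tangent_axis //.
  rewrite !mulr0 subr0 mulr0 addr0; apply/eqP; rewrite subr_eq0; apply/eqP/eq_bigr => k _.
  by rewrite lorentzZl /G gramE.
Qed.

(** Differentiate the Gauss formula paired with the fixed vector [c = X p x], which turns it into a
    sum of products of scalar functions. At [x] itself [nu] is orthogonal to [c], so the derivative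
    of [G] drops out; the derivative of [nu] is [- K X l] and produces the curvature term. *)
Lemma umbilical_third l i j p x : U x ->
  lorentz (pd l (S i j) x) (X p x) =
  \sum_m (partial l (christoffel G i j m) x
    + \sum_q christoffel G i j q x * christoffel G l q m x) * G x m p
  - K * (G x i j * G x l p).
Proof.
move=> Ux; set c := X p x.
have dX k : differentiable (X k) x by exact: (smooth_on_differentiable (sX k)).
have dG k m q : differentiable (christoffel G k m q) x.
  exact: (smooth_on_differentiable (smooth_christoffel k m q)).
have cE (f : 'rV[R]_3 -> E) : differentiable f x ->
    is_derive x (delta_mx 0 l) (fun y => lorentz (f y) c : R) (lorentz (pd l f x) c).
  move=> df; apply: is_derive_eq; first exact: (is_derive_lorentz _ df (differentiable_cst c x)).
  by rewrite derive_cst lorentz0r addr0 pdE.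
have <- : partial l (fun y => lorentz (S i j y) c : R) x = lorentz (pd l (S i j) x) c.
  by apply: derive_val; apply: cE; exact: (smooth_on_differentiable (sS i j)).
rewrite (@partial_eq_on _ _ U _ ((\sum_k ((christoffel G i j k) * (fun y => lorentz (X k y) c : R)))
   + (fun y => G y i j) * (fun y => lorentz (nu y) c : R)) l x) //; last first.
  move=> y Uy; rewrite umbilical_gauss_formula // lorentzDl lorentz_suml lorentzZl.
  rewrite fctE fct_sumE; congr (_ + _).
  by apply: eq_bigr => k _; rewrite lorentzZl.
have dnu : is_derive x (delta_mx 0 l) (fun y => lorentz (nu y) c : R) (- K * G x l p).
  rewrite (_ : (fun y => _) = (- K) *: (fun y => lorentz (phi y) c : R)); last first.
    apply: funext => y; rewrite /nu !lorentzE (lorentzC a) umbilical_tangent_axis //.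
    by rewrite mulr0 subr0 fctE.
  apply: is_derive_eq; first by apply: is_deriveZ; apply: cE; exact: dphi.
  by rewrite /G gramE.
have dg : is_derive x (delta_mx 0 l) (fun y => G y i j : R) (partial l (fun y => G y i j : R) x).
  by apply/derivableP/diff_derivable; exact: (smooth_on_differentiable (smooth_gram i j)).
have dS k : is_derive x (delta_mx 0 l) (christoffel G i j k * (fun y => lorentz (X k y) c : R))
    (christoffel G i j k x * lorentz (S l k x) c + G x k p * partial l (christoffel G i j k) x).
  apply: is_derive_eq; first apply: is_deriveM.
  - by apply/derivableP/diff_derivable; exact: dG.
  - by apply: cE; exact: dX.
  - by rewrite /G gramE.
apply: derive_val; apply: (is_derive_eq (is_deriveD (is_derive_sum dS) (is_deriveM dg dnu))).
have -> : lorentz (nu x) c = 0.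
  rewrite /nu !lorentzE !(lorentzC _ c) umbilical_tangent_position // umbilical_tangent_axis //.
  by rewrite !mulr0 subrr.
rewrite [0 *: _]scale0r addr0; congr (_ + _); last first.
  by rewrite [LHS]mulrCA mulNr.
under [RHS]eq_bigr do rewrite mulrDl.
rewrite [RHS]big_split [RHS]addrC [LHS]big_split /=; congr (_ + _); last first.
  by apply: eq_bigr => k _; exact: mulrC.
under eq_bigr do rewrite -christoffel_gram // mulr_sumr.
rewrite exchange_big; apply: eq_bigr => m _; rewrite mulr_suml; apply: eq_bigr => q _.
exact: mulrA.
Qed.

(** The Gauss equation, from [d_i d_j d_k = d_j d_i d_k] on [phi]: in the difference, the
    Christoffel terms assemble into the curvature coefficients and the terms coming from [nu] into
    the right-hand side. *)
Theorem umbilical_curvature_coef i j k p x : U x ->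
  \sum_m curvature_coef G i j k m x * G x m p =
  K * (G x j k * G x i p - G x i k * G x j p).
Proof.
move=> Ux.
have : lorentz (pd i (S j k) x) (X p x) - lorentz (pd j (S i k) x) (X p x) = 0.
  by rewrite /S (pd_sym i j oU (sX k) Ux) subrr.
rewrite !umbilical_third // => /eqP; rewrite opprD opprK addrACA addr_eq0 -sumrB => /eqP e.
transitivity (\sum_m ((partial i (christoffel G j k m) x
    + \sum_q christoffel G j k q x * christoffel G i q m x) * G x m p -
   (partial j (christoffel G i k m) x
    + \sum_q christoffel G i k q x * christoffel G j q m x) * G x m p)).
  apply: eq_bigr => m _; rewrite /curvature_coef sumrB -mulrBl; congr (_ * _).
  by rewrite opprD addrACA.
by rewrite e mulrBr opprD opprK.
Qed.

Let exchange_big_inner (f : 'I_3 -> 'I_3 -> 'I_3 -> R) :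
  \sum_m \sum_p \sum_i f m p i = \sum_i \sum_m \sum_p f m p i.
Proof. by rewrite [RHS]exchange_big; apply: eq_bigr => m _; exact: exchange_big. Qed.

Theorem umbilical_sectional_curvature x v w : U x -> row_free (col_mx v w) ->
  sectional_curvature G x v w = K.
Proof.
move=> Ux vw.
have GT : (G x)^T = G x by exact: gram_sym.
have D := posdef_cauchy GT (umbilical_gram_posdef Ux) vw.
rewrite /sectional_curvature; apply: (canLR (mulfK _)); first by rewrite gt_eqF.
transitivity (\sum_i \sum_j \sum_k \sum_p v 0 i * w 0 j * w 0 k * v 0 p *
     \sum_m curvature_coef G i j k m x * G x m p).
  transitivity (\sum_m \sum_p \sum_i \sum_j \sum_k
      v 0 i * w 0 j * w 0 k * v 0 p * (curvature_coef G i j k m x * G x m p)).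
    rewrite bilinE; apply: eq_bigr => m _; apply: eq_bigr => p _; rewrite mxE !mulr_suml.
    apply: eq_bigr => i _; rewrite !mulr_suml; apply: eq_bigr => j _.
    rewrite !mulr_suml; apply: eq_bigr => k _; ring.
  rewrite exchange_big_inner; apply: eq_bigr => i _.
  rewrite exchange_big_inner; apply: eq_bigr => j _.
  rewrite exchange_big_inner; apply: eq_bigr => k _.
  by rewrite exchange_big; apply: eq_bigr => p _; rewrite mulr_sumr.
under eq_bigr do under eq_bigr do under eq_bigr do under eq_bigr do
  rewrite umbilical_curvature_coef //.
have -> : bilin (G x) v v * bilin (G x) w w = \sum_i \sum_j \sum_k \sum_p
    (v 0 i * G x i p * v 0 p) * (w 0 j * G x j k * w 0 k).
  rewrite !bilinE mulr_suml; apply: eq_bigr => i _; rewrite mulr_sumr; apply: eq_bigr => j _.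
  by rewrite mulr_sumr; apply: eq_bigr => k _; rewrite mulr_suml.
have -> : bilin (G x) v w ^+ 2 = \sum_i \sum_j \sum_k \sum_p
    (v 0 i * G x i k * w 0 k) * (w 0 j * G x j p * v 0 p).
  rewrite expr2 {2}(bilinC v w GT) !bilinE mulr_suml; apply: eq_bigr => i _.
  rewrite mulr_sumr; apply: eq_bigr => j _; rewrite mulr_suml; apply: eq_bigr => k _.
  by rewrite mulr_sumr.
rewrite -sumrB mulr_sumr; apply: eq_bigr => i _; rewrite -sumrB mulr_sumr; apply: eq_bigr => j _.
rewrite -sumrB mulr_sumr; apply: eq_bigr => k _; rewrite -sumrB mulr_sumr; apply: eq_bigr => p _.
move: (v 0 i) (w 0 j) (w 0 k) (v 0 p) (G x j k) (G x i p) (G x i k) (G x j p) => *; ring.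
Qed.

End UmbilicalCurvature.

(** * An explicit local parametrization of an umbilical hypersurface *)

Section UmbilicalParametrization.
Context {R : realType}.
Notation E := 'rV[R]_5.

(** The orthogonal complement is the kernel of a linear map to R^2, of rank at least 3; [pid_mx]
    selects three rows of a basis of it. *)
Lemma orthogonal_triple (x y : E) : exists2 B : 'M[R]_(3, 5), row_free B &
  forall v : 'rV[R]_3, lorentz (v *m B) x = 0 /\ lorentz (v *m B) y = 0.
Proof.
pose L : 'M[R]_(5, 2) := \matrix_(i, j) lorentz (delta_mx 0 i) (if j == 0 then x else y).
have LE (w : E) j : (w *m L) 0 j = lorentz w (if j == 0 then x else y).
  rewrite mxE [in RHS](row_sum_delta w) lorentz_suml; apply: eq_bigr => i _.
  by rewrite lorentzZl mxE.
have rk : (3 <= \rank (kermx L))%N.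
  by rewrite mxrank_ker; have := rank_leq_col L; case: (\rank L) => [|[|[|]]].
pose B := (pid_mx 3 : 'M[R]_(3, \rank (kermx L))) *m row_base (kermx L).
have BL : B *m L = 0.
  have /sub_kermxP : (row_base (kermx L) <= kermx L)%MS by rewrite eq_row_base.
  by rewrite /B -mulmxA => ->; rewrite mulmx0.
exists B; first by rewrite /row_free /B mxrankMfree ?row_base_free // rank_pid_mx.
move=> v; have vBL : v *m B *m L = 0 by rewrite -mulmxA BL mulmx0.
by split; [have := LE (v *m B) 0 | have := LE (v *m B) 1]; rewrite vBL mxE /= => <-.
Qed.

Lemma smooth_on_mulmxr m n p (U : set 'M[R]_(m, n)) (B : 'M[R]_(n, p)) :
  open U -> smooth_on U (mulmxr B).
Proof.
move=> oU; apply: smooth_on_mx => // i k.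
apply: (@smooth_on_ext _ _ R _ (fun v : 'M[R]_(m, n) => \sum_j v i j * B j k : R)) => //.
  by move=> v _; rewrite /= mxE.
apply: smooth_on_sum => // j; apply: smooth_onM => //; first exact: smooth_on_coord.
exact: smooth_on_cst.
Qed.

Lemma is_derive_mulmxr m n p (B : 'M[R]_(n, p)) (v u : 'M[R]_(m, n)) :
  is_derive v u (mulmxr B) (u *m B).
Proof.
have d : differentiable (mulmxr B) v.
  exact: (smooth_on_differentiable (smooth_on_mulmxr B openT)).
split; first exact: diff_derivable.
by rewrite -[mulmxr B]/(id \o mulmxr B) derive_comp_linear derive_id.
Qed.

(** [constant_curvature] constrains [K] only through existing parametrizations, so one is exhibited:
    stereographic coordinates about a point [x0], with the conformal factor [2 / (1 + K |v|^2)] of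
    the model space of curvature [K]. *)
Lemma umbilical_parametrization (a : E) (b : R) : umbilical_hypersurface a b ->
  exists (U : set 'rV[R]_3) (phi : 'rV[R]_3 -> E),
    [/\ open U, U 0, smooth_on U phi &
        forall x, U x -> umbilical a b (phi x) /\ injective ('d phi x)].
Proof.
move=> hQ; have D0 := umbilical_discr_gt0 hQ.
have [_ [x0 [hx0 ax0]] _] := hQ; have [xx x00] := hx0.
have [B fB BT] := orthogonal_triple x0 a.
set K := umbilical_curvature a b.
(* The vector of the span of [x0] and [a] whose products with them are -1 and 0; its squared length
   turns out to be [K]. *)
pose n0 : E := - K *: x0 - (b / (lorentz a a + b ^+ 2)) *: a.
have DN : lorentz a a + b ^+ 2 != 0 by rewrite gt_eqF.
have n0x0 : lorentz x0 n0 = -1.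
  rewrite /n0 !lorentzE xx (lorentzC x0 a) ax0 /K /umbilical_curvature.
  by move: (lorentz a a) DN => s DN; field.
have n0a : lorentz a n0 = 0.
  rewrite /n0 !lorentzE ax0 /K /umbilical_curvature.
  by move: (lorentz a a) DN => s DN; field.
have n0n0 : lorentz n0 n0 = K.
  rewrite {1}/n0 lorentzDl lorentzNl !lorentzZl n0x0 n0a; ring.
pose N v := lorentz (v *m B) (v *m B).
have N0 v : v != 0 -> 0 < N v.
  move=> v0; apply: (H4_spacelike hx0); first by rewrite lorentzC; case: (BT v).
  by rewrite mulmx_free_eq0.
have vn0 v : lorentz (v *m B) n0 = 0.
  by have [vx va] := BT v; rewrite /n0 lorentzDr lorentzNr !lorentzZr vx va; ring.
clearbody n0.
pose D v := 1 + K * N v.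
pose w v := v *m B + N v *: n0.
pose P v := D v * x0 0 0 + 2 * w v 0 0.
(* For nonzero [v], the line through [x0] in direction [w v] stays in the hyperplane and meets the
   quadric [<x, x> = -1] again at parameter [2 / D v]. *)
pose phi v := x0 + (2 / D v) *: w v.
(* [P v / D v] is the time coordinate of [phi v], so the second condition selects the upper
   sheet. *)
pose U := [set v | 0 < D v /\ 0 < P v].
have smB : smooth_on [set: 'rV[R]_3] (mulmxr B) by exact: smooth_on_mulmxr openT.
have sN : smooth_on [set: 'rV[R]_3] N by exact: (smooth_on_lorentz openT smB smB).
have sD : smooth_on [set: 'rV[R]_3] D.
  apply: (smooth_onD openT); first exact: (smooth_on_cst _ openT).
  by apply: (smooth_onM openT) => //; exact: (smooth_on_cst _ openT).
have sw k : smooth_on [set: 'rV[R]_3] (fun v => w v 0 k : R).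
  apply: (@smooth_on_ext _ _ R _ (fun v => mulmxr B v 0 k + N v * cst (n0 0 k) v)) => //.
  - exact: openT.
  - by move=> v _; rewrite !mxE /=; congr (_ + _).
  - apply: (smooth_onD openT); first exact: (smooth_on_entry _ _ openT smB).
    by apply: (smooth_onM openT) => //; exact: (smooth_on_cst _ openT).
have sP : smooth_on [set: 'rV[R]_3] P.
  apply: (smooth_onD openT); apply: (smooth_onM openT) => //; exact: (smooth_on_cst _ openT).
have cD : continuous D.
  by move=> v; apply: differentiable_continuous; exact: (smooth_on_differentiable sD).
have cP : continuous P.
  by move=> v; apply: differentiable_continuous; exact: (smooth_on_differentiable sP).
have oU : open U.
  have -> : U = (D @^-1` [set r | 0 < r]) `&` (P @^-1` [set r | 0 < r]) by [].
  by apply: openI; apply: open_comp => [v _|]; [exact: cD | exact: open_gt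
                                               |exact: cP | exact: open_gt].
have smU (f : 'rV[R]_3 -> R) : smooth_on [set: 'rV[R]_3] f -> smooth_on U f.
  by move=> sf s v _; exact: sf.
have DU v : U v -> D v != 0 by case=> d _; rewrite gt_eqF.
have sphi : smooth_on U phi.
  apply: (smooth_on_mx oU) => i k; rewrite (ord1 i).
  apply: (@smooth_on_ext _ _ R _ (fun v => cst (x0 0 k) v + cst 2 v * (D v)^-1 * w v 0 k)) => //.
    by move=> v _; rewrite !mxE.
  apply: smooth_onD => //; first exact: smooth_on_cst.
  apply: smooth_onM => //; last exact: smU.
  apply: smooth_onM => //; first exact: smooth_on_cst.
  by apply: smooth_onV => //; exact: smU.
have wx0 v : lorentz (w v) x0 = - N v.
  by have [vx _] := BT v; rewrite /w lorentzDl lorentzZl vx (lorentzC n0) n0x0; ring.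
exists U, phi; split => //.
  have N00 : N 0 = 0 by rewrite /N mul0mx lorentz0l.
  rewrite /U /= /P /w /D N00 mulr0 addr0 mul0mx scale0r addr0 mxE mulr0 addr0 mul1r.
  by split=> //; exact: ltr01.
move=> v Uv; have [Dv Pv] := Uv; split.
  split; last first.
    rewrite /hyperplane /= /phi lorentzDr lorentzZr ax0 /w lorentzDr lorentzZr n0a.
    by have [_ va] := BT v; rewrite (lorentzC a) va; ring.
  split.
    have ww : lorentz (w v) (w v) = N v * D v.
      rewrite /w !lorentzE n0n0 vn0 (lorentzC n0) vn0 /D -/(N v); ring.
    have sq (p z : E) t : lorentz (p + t *: z) (p + t *: z) =
        lorentz p p + 2 * t * lorentz z p + t ^+ 2 * lorentz z z.
      by rewrite !lorentzE (lorentzC p z); ring.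
    rewrite /phi sq xx ww wx0.
    by field; exact: DU.
  rewrite /phi mxE [X in _ + X]mxE; have -> : x0 0 0 + 2 / D v * (w v) 0 0 = P v / D v.
    by rewrite /P; field; exact: DU.
  by rewrite divr_gt0.
have dphi := smooth_on_differentiable sphi Uv.
suff inj0 u : 'd phi v u = 0 -> u = 0.
  move=> u1 u2 e; apply/eqP; rewrite -subr_eq0; apply/eqP/inj0.
  by rewrite linearB /= e subrr.
rewrite -deriveE // => du; apply/eqP; apply: contraT => u0.
have phic c : is_derive v u (fun y => lorentz (phi y) c : R) 0.
  apply: is_derive_eq; first exact: (is_derive_lorentz _ dphi (differentiable_cst c v)).
  by rewrite du derive_cst lorentz0r lorentz0l addr0.
(* [2 / D] is the affine function [2 + K + K f] of [f = <phi, x0>]. If the derivative of [phi] along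
   [u] vanished, both [f] and [<phi, u B> = (2 / D) q] would be stationary, whereas [q] is linear
   with positive derivative along [u]. *)
pose f y := lorentz (phi y) x0 : R; pose q y := lorentz (y *m B) (u *m B) : R.
have dq : is_derive v u q (lorentz (u *m B) (u *m B)).
  apply: is_derive_eq.
    apply: (@is_derive_lorentz _ _ (mulmxr B) (cst (u *m B))); last exact: differentiable_cst.
    exact: (smooth_on_differentiable smB).
  by rewrite derive_cst lorentz0r addr0 (@derive_val _ _ _ _ _ _ _ (is_derive_mulmxr B v u)).
have fE y : U y -> lorentz (phi y) (u *m B) = (cst (2 + K) + K *: f) y * q y.
  move=> Uy; have [ux _] := BT u; rewrite /phi lorentzDl lorentzZl (lorentzC x0) ux add0r.
  rewrite /w lorentzDl lorentzZl (lorentzC n0) vn0 mulr0 addr0 -/(q y); congr (_ * _).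
  rewrite !fctE /f /phi lorentzDl lorentzZl xx wx0.
  change (2 / D y = 2 + K + K * (-1 + 2 / D y * - N y)).
  by have := DU y Uy; rewrite /D => d; field.
have df : is_derive v u f 0 by exact: phic.
have eqD : 'D_u (fun y => lorentz (phi y) (u *m B) : R) v =
       'D_u ((cst (2 + K) + K *: f) * q) v.
  apply: near_eq_derive; have : nbhs v U by exact: open_nbhs_nbhs.
  by apply: filterS => y Uy; exact: fE.
have dk : is_derive v u (cst (2 + K) + K *: f) (0 + K *: 0).
  by apply: is_deriveD; exact: is_deriveZ.
have := etrans (esym (@derive_val _ _ _ _ _ _ _ (phic _)))
  (etrans eqD (@derive_val _ _ _ _ _ _ _ (is_deriveM dk dq))).
rewrite [K *: 0]scaler0 addr0 [q v *: _]scaler0 addr0.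
have -> : (cst (2 + K) + K *: f) v = 2 / D v.
  rewrite !fctE /f /phi lorentzDl lorentzZl xx wx0.
  change (2 + K + K * (-1 + 2 / D v * - N v) = 2 / D v).
  by have := DU v Uv; rewrite /D => d; field.
move=> /esym/eqP; rewrite mulf_eq0 => /orP[|].
  by rewrite gt_eqF // divr_gt0.
by rewrite gt_eqF //; exact: N0.
Qed.

End UmbilicalParametrization.

(** * Local geometry of the suspension *)

Section Warp.
Context {R : realType} {n : nat}.
Notation E := 'rV[R]_5.
Implicit Types (m s : R -> R) (f : 'rV[R]_n -> E) (c : E) (y v : 'rV[R]_(n + 1)).

Definition height y : R := rsubmx y 0 0.

(** The profiles [m], [s] and the map [f] are left free so that one derivative formula can be
    iterated: the partial derivatives of the suspension are again of this form. *)
Definition warp m s f c : 'rV[R]_(n + 1) -> E :=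
  fun y => m (height y) *: f (lsubmx y) + s (height y) *: c.

Lemma smooth_on_height (U : set 'rV[R]_(n + 1)) : open U -> smooth_on U height.
Proof.
move=> oU; apply: (@smooth_on_ext _ _ R _ (fun y : 'rV[R]_(n + 1) => y 0 (rshift n 0) : R)) => //.
  by move=> y _; rewrite /height mxE.
exact: smooth_on_coord.
Qed.

Lemma differentiable_height y : differentiable height y.
Proof. exact: (smooth_on_differentiable (smooth_on_height openT)). Qed.

Lemma derive_height y v : 'D_v height y = height v.
Proof.
have dr : differentiable (rsubmx : 'rV[R]_(n + 1) -> 'rV[R]_1) y.
  exact: differentiable_rsubmx.
rewrite -(derive_entry v 0 0 dr).
by rewrite -[rsubmx : 'rV[R]_(n + 1) -> 'rV[R]_1]/(id \o rsubmx) derive_comp_linear derive_id.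
Qed.

Lemma is_derive_height_comp m (m' : R) y v : is_derive (height y) 1 m m' ->
  is_derive y v (m \o height) (height v * m').
Proof.
move=> dm; have dfm : differentiable m (height y).
  by apply/derivable1_diffP; exact: ex_derive.
have dfh := differentiable_height y.
have dmh : differentiable (m \o height) y by exact: differentiable_comp.
split; first exact: diff_derivable.
have eh : 'd height y v = height v by rewrite -deriveE // derive_height.
have em : 'd m (height y) 1 = m' by rewrite -deriveE // derive_val.
by rewrite deriveE // diff_comp //= eh -[X in 'd m _ X]mulr1 [LHS]linearZ /= em.
Qed.

Lemma warp_derive m s f c (m' s' : R) y v : differentiable f (lsubmx y) ->
  is_derive (height y) 1 m m' -> is_derive (height y) 1 s s' ->
  differentiable (warp m s f c) y /\
  'D_v (warp m s f c) y =
    (height v * m') *: f (lsubmx y) + m (height y) *: 'D_(lsubmx v) f (lsubmx y)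
    + (height v * s') *: c.
Proof.
move=> df dm ds.
have dfl : differentiable (f \o lsubmx) y.
  by apply: differentiable_comp => //; exact: differentiable_lsubmx.
have dmh : differentiable (m \o height) y.
  apply: differentiable_comp; first exact: differentiable_height.
  by apply/derivable1_diffP; exact: ex_derive.
have dsh : differentiable (s \o height) y.
  apply: differentiable_comp; first exact: differentiable_height.
  by apply/derivable1_diffP; exact: ex_derive.
have wE k : (fun z => warp m s f c z 0 k) =
   (m \o height) * (fun z => (f \o lsubmx) z 0 k : R) + (s \o height) * cst (c 0 k).
  by apply: funext => z; rewrite /warp !mxE.
have dw : differentiable (warp m s f c) y.
  apply: differentiable_mx => i k; rewrite (ord1 i) wE.
  apply: differentiableD; apply: differentiableM => //.
  exact: differentiable_entry.
split=> //; apply/rowP => k; rewrite derive_entry // wE.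
have df1 : is_derive y v (fun z => (f \o lsubmx) z 0 k : R) ('D_(lsubmx v) f (lsubmx y) 0 k).
  rewrite -derive_comp_linear derive_entry //.
  by apply/derivableP/diff_derivable/differentiable_entry.
have dm1 := is_derive_height_comp v dm; have ds1 := is_derive_height_comp v ds.
have dc : is_derive y v (cst (c 0 k) : 'rV[R]_(n + 1) -> R) 0 by exact: is_derive_cst.
apply: etrans (@derive_val _ _ _ _ _ _ _ (is_deriveD (is_deriveM dm1 df1) (is_deriveM ds1 dc))) _.
rewrite !mxE /= [_ *: 0]scaler0 add0r; congr (_ + _); last exact: mulrC.
by rewrite addrC; congr (_ + _); exact: mulrC.
Qed.

Lemma height_lshift (i : 'I_n) : height (delta_mx 0 (lshift 1 i)) = 0.
Proof. by rewrite /height !mxE eq_rlshift andbF. Qed.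

Lemma height_rshift : height (delta_mx 0 (rshift n 0)) = 1.
Proof. by rewrite /height !mxE !eqxx. Qed.

Lemma lsubmx_lshift (i : 'I_n) :
  lsubmx (delta_mx 0 (lshift 1 i) : 'rV[R]_(n + 1)) = delta_mx 0 i.
Proof. by apply/rowP => j; rewrite !mxE eq_lshift. Qed.

Lemma lsubmx_rshift : lsubmx (delta_mx 0 (rshift n 0) : 'rV[R]_(n + 1)) = 0.
Proof. by apply/rowP => j; rewrite !mxE eq_lrshift andbF. Qed.

Lemma pd_warp_l m s f c y i : differentiable f (lsubmx y) ->
  derivable m (height y) 1 -> derivable s (height y) 1 ->
  pd (lshift 1 i) (warp m s f c) y = m (height y) *: pd i f (lsubmx y).
Proof.
move=> df /derivableP dm /derivableP ds.
have [_ E1] := warp_derive c (delta_mx 0 (lshift 1 i)) df dm ds.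
rewrite pdE [LHS]E1 height_lshift lsubmx_lshift !mul0r !scale0r add0r addr0.
by rewrite pdE.
Qed.

Lemma pd_warp_r m s f c (m' s' : R) y : differentiable f (lsubmx y) ->
  is_derive (height y) 1 m m' -> is_derive (height y) 1 s s' ->
  pd (rshift n 0) (warp m s f c) y = m' *: f (lsubmx y) + s' *: c.
Proof.
move=> df dm ds; have [_ E1] := warp_derive c (delta_mx 0 (rshift n 0)) df dm ds.
by rewrite pdE [LHS]E1 height_rshift lsubmx_rshift derive0 scaler0 addr0 !mul1r.
Qed.

End Warp.

Section Hyperbolic.
Context {R : realType}.

Lemma is_derive_cosh (t : R) : is_derive t 1 (@cosh R) (sinh t).
Proof.
have dN : is_derive t 1 (expR \o -%R : R -> R) (- expR (- t)).
  have := is_derive1_comp (is_derive_expR (- t)) (is_deriveNid t 1).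
  by rewrite mulrN1.
rewrite (_ : @cosh R = 2^-1 *: (expR + (expR \o -%R))); last first.
  by apply: funext => s; rewrite /cosh !fctE mulrC.
apply: is_derive_eq.
by rewrite /sinh mulrC.
Qed.

Lemma is_derive_sinh (t : R) : is_derive t 1 (@sinh R) (cosh t).
Proof.
have dN : is_derive t 1 (expR \o -%R : R -> R) (- expR (- t)).
  have := is_derive1_comp (is_derive_expR (- t)) (is_deriveNid t 1).
  by rewrite mulrN1.
rewrite (_ : @sinh R = 2^-1 *: (expR - (expR \o -%R))); last first.
  by apply: funext => s; rewrite /sinh !fctE mulrC.
apply: is_derive_eq.
by rewrite /cosh opprK mulrC.
Qed.

Lemma smooth_on_cosh_sinh {V : normedModType R} (U : set V) (f : V -> R) : open U ->
  smooth_on U f -> smooth_on U (cosh \o f) /\ smooth_on U (sinh \o f).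
Proof.
move=> oU sf.
have sN : smooth_on U (fun x => cst (-1) x * expR (cst (-1) x * f x)).
  apply: smooth_onM => //; first exact: smooth_on_cst.
  by apply: smooth_on_expR => //; apply: smooth_onM => //; exact: smooth_on_cst.
have sP : smooth_on U (fun x => expR (cst (-1) x * f x)).
  by apply: smooth_on_expR => //; apply: smooth_onM => //; exact: smooth_on_cst.
have se : smooth_on U (fun x => expR (f x)) by exact: smooth_on_expR.
split.
  apply: (@smooth_on_ext _ _ R _
    (fun x => (expR (f x) + expR (cst (-1) x * f x)) * cst 2^-1 x)) => //.
    by move=> x _; rewrite /= /cosh mulN1r.
  by apply: smooth_onM => //; [exact: smooth_onD | exact: smooth_on_cst].
apply: (@smooth_on_ext _ _ R _
    (fun x => (expR (f x) + cst (-1) x * expR (cst (-1) x * f x)) * cst 2^-1 x)) => //.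
  by move=> x _; rewrite /= /sinh !mulN1r.
by apply: smooth_onM => //; [exact: smooth_onD | exact: smooth_on_cst].
Qed.

End Hyperbolic.

(** * Eigenvalues of a traceless self-adjoint operator in dimension 2 *)

Section TracelessShape.
Context {R : realType}.

Lemma det_mx2 (S : comNzRingType) (A : 'M[S]_2) :
  \det A = A 0 0 * A 1 1 - A 0 1 * A 1 0.
Proof.
rewrite (expand_det_row _ 0) !big_ord_recl big_ord0 addr0 /cofactor !det_mx11 !mxE /=.
rewrite expr0 mul1r expr1 mulN1r mulrN.
by congr (_ * A _ _ - A _ _ * A _ _); apply/val_inj.
Qed.

(* Self-adjointness of [P] gives [E det P = - g(w, w)], [w] the first row of [P] and [E] the first
   entry of [g]. *)
Lemma traceless_self_adjoint_det (P g : 'M[R]_2) : g^T = g -> posdef g ->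
  (P *m g)^T = P *m g -> \tr P = 0 -> \det P <= 0.
Proof.
move=> gT pg PgT trP.
have E0 : 0 < g 0 0.
  have := pg (delta_mx 0 0); rewrite /bilin -rowE trmx_delta -colE !mxE; apply.
  by apply/eqP => /rowP/(_ 0); rewrite !mxE /= => /eqP; rewrite oner_eq0.
have := posdef_ge0 (row 0 P) pg; rewrite bilinE !big_ord_recl !big_ord0 !addr0 !mxE.
have o1 : lift 0 0 = 1 :> 'I_2 by apply/val_inj.
rewrite !o1.
have g10 : g 1 0 = g 0 1 by have /matrixP/(_ 0 1) := gT; rewrite mxE.
have /matrixP/(_ 0 1) := PgT; rewrite !mxE !big_ord_recl !big_ord0 !addr0 !o1.
move: trP; rewrite /mxtrace !big_ord_recl big_ord0 addr0 o1 det_mx2 g10.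
move: (P 0 0) (P 0 1) (P 1 0) (P 1 1) (g 0 0) (g 0 1) (g 1 1) E0 => p q r s E F G E0.
move=> tr sym q0.
have sE : s = - p by lra.
have : 0 <= E * (p ^+ 2 + q * r).
  have -> : E * (p ^+ 2 + q * r) = E * p ^+ 2 + q * (r * E) by ring.
  have -> : r * E = 2 * p * F + q * G by rewrite sE in sym; lra.
  by apply: le_trans q0 _; rewrite le_eqVlt; apply/orP; left; apply/eqP; ring.
by rewrite pmulr_rge0 // sE; lra.
Qed.

Lemma char_poly_traceless (P : 'M[R]_2) : \tr P = 0 ->
  char_poly P = 'X ^+ 2 + (\det P)%:P.
Proof.
move=> trP; rewrite /char_poly !det_mx2 !mxE /= /mulr1n.
have : P 0 0 + P 1 1 = 0.
  rewrite -trP /mxtrace !big_ord_recl big_ord0 addr0; congr (_ + P _ _); exact/val_inj.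
move=> /eqP; rewrite addr_eq0 => /eqP ->.
rewrite !mulr0n; move: (P 1 1) (P 0 1) (P 1 0) => s q r.
rewrite polyCB !polyCM !polyCN; ring.
Qed.

(** [principal_curvatures] asks the characteristic polynomial to split over the reals; a nonpositive
    determinant supplies the roots [r] and [- r] of the block, and the corner supplies 0. *)
Lemma traceless_block_eigenvalues (P : 'M[R]_2) : \tr P = 0 -> \det P <= 0 ->
  exists2 k : (2 + 1).-tuple R,
    char_poly (block_mx P 0 0 (0 : 'M[R]_1)) = \prod_(i < 2 + 1) ('X - (tnth k i)%:P) &
    \prod_(i < 2 + 1) tnth k i = 0.
Proof.
move=> trP dP; set r := Num.sqrt (- \det P).
exists [tuple r; - r; 0]; last first.
  by rewrite (bigD1 ord_max) //= (tnth_nth 0) mul0r.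
rewrite /char_poly char_block_diag_mx det_ublock.
rewrite -/(char_poly P) -/(char_poly (0 : 'M[R]_1)) char_poly_traceless //.
rewrite !big_ord_recl big_ord0 !(tnth_nth 0) /= mulr1 subr0.
have -> : char_poly (0 : 'M[R]_1) = 'X by rewrite /char_poly det_mx11 !mxE subr0.
rewrite mulrA; congr (_ * _).
have -> : (\det P) = - r ^+ 2 by rewrite sqr_sqrtr ?opprK // oppr_ge0.
rewrite polyCN polyCN rmorphXn /=; ring.
Qed.

End TracelessShape.

Section LocalSuspension.
Context {R : realType} {n : nat}.
Notation E := 'rV[R]_5.
Variables (a : E) (b al : R) (U : set 'rV[R]_n) (f : 'rV[R]_n -> E).
Hypothesis alE : al ^+ 2 * (lorentz a a + b ^+ 2) = 1.
Hypotheses (oU : open U) (sf : smooth_on U f).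
Hypothesis fQ : forall x, U x -> umbilical a b (f x).

(** With [be = al * b], the unit normal [al (a + b x)] of [Q] has derivative [be] times the identity
    on tangent vectors, so [be] is up to sign the principal curvature of [Q]. *)
Definition warping (be : R) (t : R) : R := cosh t + be * sinh t.

Let mu := warping (al * b).
Let sh (t : R) := al * sinh t.
Let F := warp mu sh f a.
Let W := (lsubmx : 'rV[R]_(n + 1) -> 'rV[R]_n) @^-1` U.

Lemma is_derive_warping (be t : R) : is_derive t 1 (warping be) (sinh t + be * cosh t).
Proof.
have dc := is_derive_cosh t; have ds := is_derive_sinh t.
rewrite (_ : warping be = @cosh R + be *: @sinh R); last by apply: funext.
by apply: is_deriveD; exact: is_deriveZ.
Qed.

Lemma is_derive_warping_derive (be t : R) :
  is_derive t 1 (fun t => sinh t + be * cosh t) (warping be t).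
Proof.
have dc := is_derive_cosh t; have ds := is_derive_sinh t.
rewrite (_ : (fun t => _) = @sinh R + be *: @cosh R); last by apply: funext.
by apply: is_deriveD; exact: is_deriveZ.
Qed.

Lemma is_derive_al_sinh (t : R) : is_derive t 1 sh (al * cosh t).
Proof. have ds := is_derive_sinh t; exact: (is_deriveZ al ds). Qed.

Lemma is_derive_al_cosh (t : R) : is_derive t 1 (fun t => al * cosh t) (sh t).
Proof. have dc := is_derive_cosh t; exact: (is_deriveZ al dc). Qed.

Lemma open_cylinder : open W.
Proof. by apply: open_comp => // y _; exact: continuous_lsubmx. Qed.

Lemma smooth_on_local_suspension : smooth_on W F.
Proof.
have oW := open_cylinder.
have [sc ss] := smooth_on_cosh_sinh oW (smooth_on_height oW).
apply: (smooth_on_mx oW) => i k; rewrite (ord1 i).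
apply: (@smooth_on_ext _ _ R _ (fun y => ((cosh \o height) y + cst (al * b) y * (sinh \o height) y)
   * (f \o lsubmx) y 0 k + cst (al * a 0 k) y * (sinh \o height) y)) => //.
  by move=> y _; rewrite /F /warp /mu /warping /sh !mxE /= /cst; ring.
apply: smooth_onD => //; apply: smooth_onM => //; last first.
- exact: smooth_on_cst.
- apply: smooth_on_entry => //; apply: smooth_on_comp_linear => //; exact: continuous_lsubmx.
apply: smooth_onD => //; apply: smooth_onM => //; exact: smooth_on_cst.
Qed.

Let df x : U x -> differentiable f x. Proof. exact: smooth_on_differentiable. Qed.

Let pd_position i x : U x -> lorentz (pd i f x) (f x) = 0.
Proof. exact: (umbilical_pd_position oU df fQ). Qed.

Let pd_axis i x : U x -> lorentz (pd i f x) a = 0.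
Proof. exact: (umbilical_pd_axis oU df fQ). Qed.

Lemma pd_suspension_l i y : W y -> pd (lshift 1 i) F y = mu (height y) *: pd i f (lsubmx y).
Proof.
move=> Wy; apply: pd_warp_l; first exact: df.
  exact: (@ex_derive _ _ _ _ _ _ _ (is_derive_warping _ _)).
exact: (@ex_derive _ _ _ _ _ _ _ (is_derive_al_sinh _)).
Qed.

Lemma pd_suspension_r y : W y -> pd (rshift n 0) F y =
  (sinh (height y) + al * b * cosh (height y)) *: f (lsubmx y) + (al * cosh (height y)) *: a.
Proof.
move=> Wy; apply: pd_warp_r; first exact: df.
  exact: is_derive_warping.
exact: is_derive_al_sinh.
Qed.

(** The profiles solve [s'' = s]: the curves over a fixed base point are geodesics of H^4, which
    makes the last diagonal entry of the second fundamental form vanish. *)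
Lemma pd_suspension_rr y : W y -> pd (rshift n 0) (pd (rshift n 0) F) y = F y.
Proof.
move=> Wy; rewrite (pd_eq_on (g := warp (fun t => sinh t + al * b * cosh t) (fun t => al * cosh t) f a)
  _ open_cylinder pd_suspension_r Wy).
apply: pd_warp_r; [exact: df | exact: is_derive_warping_derive | exact: is_derive_al_cosh].
Qed.

Let pd_warped i : forall y, W y -> pd (lshift 1 i) F y = warp mu (cst 0) (pd i f) 0 y.
Proof. by move=> y Wy; rewrite pd_suspension_l // /warp scaler0 addr0. Qed.

Lemma pd_suspension_ll i j y : W y ->
  pd (lshift 1 i) (pd (lshift 1 j) F) y = mu (height y) *: pd i (pd j f) (lsubmx y).
Proof.
move=> Wy; rewrite (pd_eq_on _ open_cylinder (pd_warped j) Wy).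
apply: pd_warp_l.
- exact: (smooth_on_differentiable (smooth_on_pd j sf)).
- exact: (@ex_derive _ _ _ _ _ _ _ (is_derive_warping _ _)).
- exact: derivable_cst.
Qed.

Lemma pd_suspension_rl j y : W y ->
  pd (rshift n 0) (pd (lshift 1 j) F) y =
  (sinh (height y) + al * b * cosh (height y)) *: pd j f (lsubmx y).
Proof.
move=> Wy; rewrite (pd_eq_on _ open_cylinder (pd_warped j) Wy).
have dX := smooth_on_differentiable (smooth_on_pd j sf) Wy.
have dm := is_derive_warping (al * b) (height y).
have d0 : is_derive (height y) 1 (cst (0 : R)) 0 by exact: is_derive_cst.
by apply: (etrans (pd_warp_r 0 dX dm d0)); rewrite scale0r addr0.
Qed.

(** The height derivative lies in the span of [f] and [a], hence is orthogonal to the slices; that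
    it is a unit vector is [alE] combined with [cosh^2 = 1 + sinh^2]. *)
Lemma gram_suspension y : W y ->
  gram F y = block_mx (mu (height y) ^+ 2 *: gram f (lsubmx y)) 0 0 1%:M.
Proof.
move=> Wy.
have rl i : lorentz (pd (rshift n 0) F y) (pd (lshift 1 i) F y) = 0.
  rewrite pd_suspension_r // pd_suspension_l // lorentzDl !lorentzZr !lorentzZl.
  by rewrite !(lorentzC _ (pd i f _)) pd_position // pd_axis // !mulr0 addr0.
apply/matrixP => i j; rewrite gramE.
case: (split_ordP i) => {}i ->; case: (split_ordP j) => {}j ->.
- rewrite block_mxEul !mxE !pd_suspension_l // lorentzZl lorentzZr mulrA.
  by rewrite -!pdE expr2.
- by rewrite block_mxEur mxE (ord1 j) lorentzC rl.
- by rewrite block_mxEdl mxE (ord1 i) rl.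
rewrite block_mxEdr (ord1 i) (ord1 j) mxE eqxx /= pd_suspension_r //.
have [[xx _] ax] := fQ Wy.
rewrite !lorentzE xx (lorentzC _ a) ax.
move: (sinh _) (cosh _) (cosh_sqr (height y)) alE => s c cs.
move: (lorentz a a) => q al1.
transitivity (c ^+ 2 * (al ^+ 2 * (q + b ^+ 2)) - s ^+ 2); first by ring.
by rewrite al1 mulr1 cs; ring.
Qed.

(** [F] and its height derivative are combinations of [f] and [a] with determinant
    [al (cosh^2 - sinh^2) = al], which is nonzero, so the 2 by 2 system for the two products can be
    solved. *)
Lemma suspension_normal y xi : W y -> lorentz (F y) xi = 0 ->
  lorentz (pd (rshift n 0) F y) xi = 0 ->
  lorentz (f (lsubmx y)) xi = 0 /\ lorentz a xi = 0.
Proof.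
move=> Wy; rewrite pd_suspension_r // {1}/F /warp !lorentzDl !lorentzZl /mu /warping /sh.
have al0 : al != 0.
  by apply: contra_eq_neq alE => ->; rewrite expr0n mul0r eq_sym oner_eq0.
move: (sinh _) (cosh _) (cosh_sqr (height y)) (lorentz (f _) xi) (lorentz a xi) => s c cs p q.
move=> e1 e2; split.
  have -> : p = p * (c ^+ 2 - s ^+ 2) by rewrite cs; ring.
  transitivity (c * ((c + al * b * s) * p + al * s * q) - s * ((s + al * b * c) * p + al * c * q)).
    by ring.
  by rewrite e1 e2; ring.
apply: (mulfI al0); rewrite mulr0.
have -> : al * q = al * q * (c ^+ 2 - s ^+ 2) by rewrite cs; ring.
transitivity ((c + al * b * s) * ((s + al * b * c) * p + al * c * q)
  - (s + al * b * c) * ((c + al * b * s) * p + al * s * q)).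
  by ring.
by rewrite e1 e2; ring.
Qed.

(** The mixed second derivatives are multiples of tangent vectors of the slice, and the double
    height derivative is [F] itself; [xi] is orthogonal to all of these. *)
Lemma second_form_suspension y xi : W y -> lorentz (f (lsubmx y)) xi = 0 ->
  lorentz a xi = 0 -> (forall i, lorentz (pd i f (lsubmx y)) xi = 0) ->
  \matrix_(i, j) lorentz (partial i (partial j F) y) xi =
  block_mx (mu (height y) *: \matrix_(i, j) lorentz (partial i (partial j f) (lsubmx y)) xi)
    0 0 (0 : 'M[R]_1).
Proof.
move=> Wy fx ax pdx.
have rl i : lorentz (pd (rshift n 0) (pd (lshift 1 i) F) y) xi = 0.
  by rewrite pd_suspension_rl // lorentzZl pdx mulr0.
apply/matrixP => i j; rewrite mxE -!pdE.
case: (split_ordP i) => {}i ->; case: (split_ordP j) => {}j ->.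
- by rewrite block_mxEul !mxE pd_suspension_ll // lorentzZl -!pdE.
- rewrite block_mxEur mxE (ord1 j).
  by rewrite (pd_sym _ _ open_cylinder smooth_on_local_suspension Wy) rl.
- by rewrite block_mxEdl mxE (ord1 i) rl.
rewrite block_mxEdr (ord1 i) (ord1 j) mxE pd_suspension_rr //.
by rewrite lorentzDl !lorentzZl fx ax !mulr0 addr0.
Qed.

End LocalSuspension.

Section BlockShape.
Context {R : realType} {n : nat}.
Implicit Types (S G : 'M[R]_n) (m : R).

Lemma block_gram_unit m G : m != 0 -> G \in unitmx ->
  block_mx (m ^+ 2 *: G) 0 0 (1%:M : 'M[R]_1) \in unitmx.
Proof.
move=> m0 uG.
have : block_mx (m ^+ 2 *: G) 0 0 1%:M *m block_mx (m ^- 2 *: invmx G) 0 0 (1%:M : 'M[R]_1) = 1%:M.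
  rewrite mulmx_block !mulmx0 !mul0mx !addr0 !add0r mulmx1.
  by rewrite -scalemxAl -scalemxAr scalerA mulfV ?expf_neq0 // scale1r mulmxV // -scalar_mx_block.
by case/mulmx1_unit.
Qed.

Lemma block_shape m S G : m != 0 -> G \in unitmx ->
  block_mx (m *: S) 0 0 (0 : 'M[R]_1) *m invmx (block_mx (m ^+ 2 *: G) 0 0 (1%:M : 'M[R]_1)) =
  block_mx (m^-1 *: (S *m invmx G)) 0 0 (0 : 'M[R]_1).
Proof.
move=> m0 uG; have uB := block_gram_unit m0 uG.
rewrite -[RHS](mulmxK uB); congr (_ *m _).
rewrite mulmx_block !mulmx0 !mul0mx !addr0 -scalemxAl -scalemxAr mulmxKV // scalerA.
by rewrite expr2 mulKf.
Qed.

Lemma bilin_block m G (v w : 'rV[R]_(n + 1)) :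
  bilin (block_mx (m ^+ 2 *: G) 0 0 1%:M) v w =
  m ^+ 2 * bilin G (lsubmx v) (lsubmx w) + height v * height w.
Proof.
rewrite /bilin -{1}(hsubmxK v) -{1}(hsubmxK w) mul_row_block !mulmx0 addr0 add0r tr_row_mx.
rewrite mul_row_col mxE mulmx1 -scalemxAr -scalemxAl mxE; congr (_ + _).
by rewrite mxE big_ord1 [X in _ * X = _]mxE.
Qed.

End BlockShape.

(** * The suspension of a minimal immersion *)

Section NormalField.
Context {R : realType}.
Notation E := 'rV[R]_5.
Variables (a : E) (b : R) (eta : E -> E).
Hypotheses (hQ : umbilical_hypersurface a b) (heta : unit_normal_field a b eta).

Let rho2 := lorentz a a + b ^+ 2.

(** Remove from [eta x] its projection on [a + b x]. The remainder is tangent to the hypersurface,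
    hence orthogonal to [eta x] as well as to [a + b x], so to itself; being tangent to H^4, it
    vanishes. *)
Lemma unit_normal_umbilical x : umbilical a b x ->
  let c := lorentz (eta x) a / rho2 in
  c ^+ 2 * rho2 = 1 /\ eta x = c *: (a + b *: x).
Proof.
move=> Qx /=; have rho0 : rho2 != 0 by rewrite gt_eqF // umbilical_discr_gt0.
have [hx ax] := Qx; have [xx _] := hx; rewrite /hyperplane /= in ax.
have [tx nx ee] := heta.2 x Qx; rewrite /tangent_H4 /= in tx.
set c := _ / _; pose z := eta x - c *: (a + b *: x).
have mx : lorentz x (a + b *: x) = 0 by rewrite lorentzDr lorentzZr xx (lorentzC x) ax; ring.
have ma : lorentz a (a + b *: x) = rho2 by rewrite lorentzDr lorentzZr ax /rho2 expr2.
have zx : lorentz x z = 0 by rewrite /z lorentzDr lorentzNr lorentzZr tx mx mulr0 subrr.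
have za : lorentz a z = 0.
  by rewrite /z lorentzDr lorentzNr lorentzZr ma /c (lorentzC a) divfK // subrr.
have ze : lorentz z (eta x) = 0 by apply: nx; split.
have z0 : z = 0.
  apply: (H4_spacelike_eq0 hx zx); rewrite {2}/z lorentzDr lorentzNr lorentzZr ze.
  by rewrite lorentzDr lorentzZr !(lorentzC z) za zx; ring.
have eE : eta x = c *: (a + b *: x) by apply/eqP; rewrite -subr_eq0 -/z z0.
split=> //; rewrite -[RHS]ee eE !lorentzZl !lorentzZr lorentzDl lorentzZl ma mx; ring.
Qed.

Lemma unit_normal_along (T : topologicalType) (h : T -> E) : continuous h ->
  connected [set: T] -> [set: T] !=set0 -> (forall p, umbilical a b (h p)) ->
  exists2 al, al ^+ 2 * rho2 = 1 & forall p, eta (h p) = al *: (a + b *: h p).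
Proof.
move=> ch conT [p0 _] hh.
have rho0 : rho2 != 0 by rewrite gt_eqF // umbilical_discr_gt0.
pose c p := lorentz (eta (h p)) a / rho2.
have cE p := unit_normal_umbilical (hh p).
have cc : continuous c.
  have ce : continuous (eta \o h).
    move=> p; have /subspace_continuousP/(_ _ (hh p)) := heta.1.
    move=> ce B /ce /=; rewrite /within /= => nB.
    have nB' : nbhs p (h @^-1` _) := ch p _ nB.
    by apply: (filterS _ nB') => q /=; apply; exact: hh.
  move=> p.
  apply: (@continuous_comp _ _ _ (eta \o h) (fun z => lorentz z a * rho2^-1 : R)).
    exact: ce.
  apply: differentiable_continuous; apply: differentiableM; last exact: differentiable_cst.
  by apply: (differentiable_lorentz (f := id) (g := cst a)) => //; exact: differentiable_cst.
exists (c p0); first by have [] := cE p0.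
suff cc0 p : c p = c p0 by move=> p; rewrite -(cc0 p); have [] := cE p.
pose B := [set p | c p = c p0].
suff : B = [set: T] by move=> BT; have : [set: T] p by []; rewrite -BT.
have sq q : c q ^+ 2 = c p0 ^+ 2.
  by apply: (mulIf rho0); have [-> _] := cE q; have [-> _] := cE p0.
have c0 : c p0 != 0.
  by apply/eqP => c0; have [] := cE p0; rewrite -/(c p0) c0 expr0n mul0r => /esym/eqP; rewrite oner_eq0.
apply: conT; first by exists p0.
(* The open ball of radius [|c p0|] about [c p0] misses the opposite value [- c p0]. *)
- exists (c @^-1` [set r | `|r - c p0| < `|c p0|]).
    apply: open_comp => [q _|]; first exact: cc.
    rewrite (_ : [set r | _] = ball (c p0) `|c p0|).
      by apply: ball_open; rewrite normr_gt0.
    by apply/seteqP; split => r; rewrite -ball_normE /= distrC.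
  rewrite setTI; apply/seteqP; split=> q; rewrite /B /=.
    by move=> ->; rewrite subrr normr0 normr_gt0.
  move/eqP: (sq q); rewrite eqf_sqr => /orP[/eqP //|/eqP ->].
  rewrite -opprD normrN -mulr2n normrMn => /lt_geF.
  by rewrite mulr2n lerDl normr_ge0.
- exists (c @^-1` [set c p0]); last by rewrite setTI.
  by apply: closed_comp => [q _|]; [exact: cc | exact: closed_eq].
Qed.

End NormalField.

Section ManifoldMaps.
Context {R : realType} {M : topologicalType} {n : nat}.
Variables (A : set (chart R M n)).

Lemma smooth_map_continuous (h : M -> 'rV[R]_5) : smooth_atlas A -> smooth_map A h -> continuous h.
Proof.
move=> [chA covA _] sh p; have [c Ac cp] := covA p.
have [od oi invc ccm cci] := chA c Ac.
have ip : cimage c (cmap c p) by exists p.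
have cf : {for p, continuous (local_expr h c \o cmap c)}.
  apply: continuous_comp; first exact: ccm.
  by apply: differentiable_continuous; exact: (smooth_on_differentiable (sh c Ac)).
have E : \forall q \near p, (local_expr h c \o cmap c) q = h q.
  have : nbhs p (cdom c) by exact: open_nbhs_nbhs.
  by apply: filterS => q cq; rewrite /= /local_expr /= invc.
have hp : (local_expr h c \o cmap c) p = h p by rewrite /= /local_expr /= invc.
by move=> B; rewrite -hp => /cf nB; apply: (near_eq_cvg E).
Qed.

Lemma cimage_prod (c : chart R M n) : cimage (prod_chart c) = lsubmx @^-1` cimage c.
Proof.
apply/seteqP; split=> y.
  by case=> -[p t] [/= cp _] <-; rewrite /= row_mxKl; exists p.
case=> p cp /= e; exists (p, height y) => //=.
by rewrite e -[RHS](hsubmxK y) /height -mx11_scalar.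
Qed.

End ManifoldMaps.

Section Suspension.
Context {R : realType} {M : topologicalType}.
Notation E := 'rV[R]_5.
Variables (A : set (chart R M 2)) (g : metric R M 2) (a : E) (b al : R).
Variables (eta : E -> E) (h : M -> E).
Hypotheses (atlasA : smooth_atlas A) (hg : riemannian A g).
Hypothesis alE : al ^+ 2 * (lorentz a a + b ^+ 2) = 1.
Hypothesis etaE : forall p, eta (h p) = al *: (a + b *: h p).
Hypothesis hh : isometric_immersion A g (umbilical a b) h.

Let F : M * R -> E := suspension eta h.
Let B := prod_atlas A.
Let mu := warping (al * b).

Lemma local_suspension (c : chart R M 2) : local_expr F (prod_chart c) =
  warp mu (fun t => al * sinh t) (local_expr h c) a.
Proof.
apply: funext => y; rewrite /local_expr /F /suspension /warp /= etaE /mu /warping -/(height y).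
rewrite scalerA scalerDr scalerA scalerDl -addrA; congr (_ + _).
by rewrite addrC; congr (_ *: _ + _ *: _); ring.
Qed.

Let chA c : A c -> is_chart c. Proof. by have [cA _ _] := atlasA; exact: cA. Qed.

Let oA c : A c -> open (cimage c). Proof. by case/chA. Qed.

Let invA c p : A c -> cdom c p -> cinv c (cmap c p) = p.
Proof. by move=> Ac cp; have [_ _ ic _ _] := chA Ac; exact: ic. Qed.

Let imA (c : chart R M 2) p : cdom c p -> cimage c (cmap c p). Proof. by move=> cp; exists p. Qed.

Let smA c : A c -> smooth_on (cimage c) (local_expr h c).
Proof. by have [[sm _] _ _] := hh; exact: sm. Qed.

Let hQ p : umbilical a b (h p). Proof. by have [_ Qh _] := hh; exact: Qh. Qed.

Let localQ (c : chart R M 2) x : cimage c x -> umbilical a b (local_expr h c x).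
Proof. by move=> _; exact: hQ. Qed.

Let gramA c p : A c -> cdom c p -> gram (local_expr h c) (cmap c p) = g c p.
Proof. by move=> Ac cp; have [_ _ hi] := hh; exact: hi. Qed.

Let posA c p : A c -> cdom c p -> posdef (g c p).
Proof. by move=> Ac cp; have [_ gp _] := hg; have [] := gp c p Ac cp. Qed.

Let symA c p : A c -> cdom c p -> (g c p)^T = g c p.
Proof. by move=> Ac cp; have [_ gp _] := hg; have [] := gp c p Ac cp. Qed.

Let lsubmx_cmap (c : chart R M 2) p : lsubmx (cmap (prod_chart c) p) = cmap c p.1.
Proof. by rewrite row_mxKl. Qed.

Let height_cmap (c : chart R M 2) p : height (cmap (prod_chart c) p) = p.2.
Proof. by rewrite /height row_mxKr mxE eqxx. Qed.

Let cylA (c : chart R M 2) p : cdom c p.1 -> (lsubmx @^-1` cimage c) (cmap (prod_chart c) p).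
Proof. by move=> cp; rewrite /= row_mxKl; exact: imA. Qed.

Lemma induced_metric_suspension c p : A c -> cdom c p.1 ->
  induced_metric F (prod_chart c) p = block_mx (mu p.2 ^+ 2 *: g c p.1) 0 0 1%:M.
Proof.
move=> Ac cp; rewrite /induced_metric local_suspension.
rewrite (gram_suspension alE (oA Ac) (smA Ac) (@localQ c)) ?lsubmx_cmap ?height_cmap //.
  by rewrite gramA.
exact: cylA.
Qed.

Lemma smooth_map_suspension : smooth_map B F.
Proof.
move=> _ [c Ac <-]; rewrite cimage_prod local_suspension.
exact: smooth_on_local_suspension (oA Ac) (smA Ac).
Qed.

Let dF c p : A c -> cdom c p.1 ->
  differentiable (local_expr F (prod_chart c)) (cmap (prod_chart c) p).
Proof.
move=> Ac cp; apply: (smooth_on_differentiable (U := cimage (prod_chart c))).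
  by apply: smooth_map_suspension; exists c.
by rewrite cimage_prod; exact: cylA.
Qed.

Let dh c p : A c -> cdom c p -> differentiable (local_expr h c) (cmap c p).
Proof. by move=> Ac cp; apply: (smooth_on_differentiable (smA Ac)); exact: imA. Qed.

Let pdF_l c p i : A c -> cdom c p.1 ->
  pd (lshift 1 i) (local_expr F (prod_chart c)) (cmap (prod_chart c) p) =
  mu p.2 *: pd i (local_expr h c) (cmap c p.1).
Proof.
move=> Ac cp; rewrite local_suspension (pd_suspension_l a b al (smA Ac)) ?lsubmx_cmap ?height_cmap //.
exact: cylA.
Qed.

Lemma diff_delta n (f : 'rV[R]_n -> E) x i : differentiable f x ->
  'd f x (delta_mx 0 i) = pd i f x.
Proof. by move=> df; rewrite pdE /partial deriveE. Qed.

(** Where [mu] vanishes the differential kills every slice direction. Elsewhere a kernel vector has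
    zero length for the block metric, a sum of two nonnegative terms that are definite in the base
    and height components. *)
Lemma regular_suspension : regular_point B F = [set p | mu p.2 != 0].
Proof.
have [_ covA _] := atlasA.
apply/seteqP; split=> p /=.
  have [c Ac cp] := covA p.1 => reg.
  have inj := reg (prod_chart c) (imageP _ Ac) (conj cp I).
  apply/eqP => mu0.
  have : delta_mx 0 (lshift 1 0) = 0 :> 'rV[R]_(2 + 1).
    apply: inj; rewrite linear0 diff_delta; last exact: dF.
    by rewrite pdF_l // mu0 scale0r.
  move/rowP/(_ (lshift 1 0)); rewrite !mxE !eqxx => /eqP.
  by rewrite oner_eq0.
move=> mu0 _ [c Ac <-] [/= cp _].
suff inj0 v : 'd (local_expr F (prod_chart c)) (cmap (prod_chart c) p) v = 0 -> v = 0.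
  move=> u v e; apply/eqP; rewrite -subr_eq0; apply/eqP/inj0.
  by rewrite linearB /= e subrr.
move=> dv; have := bilin_gram v v (dF Ac cp).
rewrite dv lorentz0l -/(induced_metric F (prod_chart c) p) induced_metric_suspension //.
rewrite bilin_block => /eqP.
have g0 := posdef_ge0 (lsubmx v) (posA Ac cp).
have m0 : 0 <= mu p.2 ^+ 2 * bilin (g c p.1) (lsubmx v) (lsubmx v).
  by apply: mulr_ge0 => //; exact: sqr_ge0.
rewrite -expr2 paddr_eq0 ?sqr_ge0 // => /andP[].
rewrite mulf_eq0 expf_eq0 /= (negPf mu0) /= sqrf_eq0 => lv rv.
have l0 : lsubmx v = 0.
  by apply/eqP; apply: contraTT lv => /(posA Ac cp) v0; rewrite gt_eqF.
by rewrite -(hsubmxK v) l0 [rsubmx v]mx11_scalar -/(height v) (eqP rv) raddf0 row_mx0.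
Qed.

Lemma continuous_warping be : continuous (@warping R be).
Proof.
move=> t; apply: differentiable_continuous; apply/derivable1_diffP.
exact: (@ex_derive _ _ _ _ _ _ _ (is_derive_warping be t)).
Qed.

Lemma open_regular_suspension : open (regular_point B F).
Proof.
rewrite regular_suspension.
have -> : [set p : M * R | mu p.2 != 0] = (mu \o snd) @^-1` [set r | r != 0] by [].
apply: open_comp => [p _|]; last exact: open_neq.
apply: continuous_comp; first exact: cvg_snd.
exact: continuous_warping.
Qed.

(** Slice derivatives of [F] are [mu] times those of [h], so the same vector [xi] serves as a normal
    of both, and the two shape operators can be compared. *)
Lemma unit_normal_suspension p xi : mu p.2 != 0 ->
  unit_normal tangent_H4 B F p xi -> unit_normal (tangent_umbilical a) A h p.1 xi.
Proof.
move=> mu0 [Fxi dFxi xixi]; have [_ covA _] := atlasA; rewrite /tangent_H4 /= in Fxi.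
have pdFxi c i : A c -> cdom c p.1 ->
    lorentz (pd i (local_expr F (prod_chart c)) (cmap (prod_chart c) p)) xi = 0.
  move=> Ac cp; rewrite -diff_delta; last exact: dF.
  by apply: dFxi; [exact: imageP | split].
have [c0 Ac0 cp0] := covA p.1.
have [hxi axi] : lorentz (h p.1) xi = 0 /\ lorentz a xi = 0.
  have := @suspension_normal _ _ _ _ _ _ _ alE (smA Ac0) _ xi (cylA cp0).
  rewrite -local_suspension lsubmx_cmap /local_expr /= row_mxKl row_mxKr mxE eqxx !invA //=.
  by apply; rewrite /= ?pdFxi //; case: (p) Fxi.
split => // c v Ac cp.
rewrite diff_pd; last exact: dh.
rewrite lorentz_suml big1 // => i _; rewrite lorentzZl.
have := pdFxi c (lshift 1 i) Ac cp; rewrite pdF_l // lorentzZl => /eqP.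
by rewrite mulf_eq0 (negPf mu0) /= => /eqP ->; rewrite mulr0.
Qed.

Lemma shape_operator_suspension c p xi : mu p.2 != 0 -> A c -> cdom c p.1 ->
  unit_normal tangent_H4 B F p xi ->
  shape_operator F (prod_chart c) p xi =
  block_mx ((mu p.2)^-1 *: shape_operator h c p.1 xi) 0 0 (0 : 'M[R]_1).
Proof.
move=> mu0 Ac cp nF; have [[hxi axi] dxi _] := unit_normal_suspension mu0 nF.
rewrite /shape_operator induced_metric_suspension //.
rewrite {1}/second_fundamental_form local_suspension.
rewrite (@second_form_suspension _ _ a b al (cimage c)) ?lsubmx_cmap ?height_cmap //; last 5 first.
- exact: oA.
- exact: smA.
- exact: cylA.
- by rewrite /local_expr /= invA.
- by move=> i; rewrite -diff_delta; [exact: dxi | exact: dh].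
rewrite block_shape //; last exact: posdef_unitmx (posA Ac cp).
by congr (block_mx (_ *: (_ *m invmx _)) _ _ _); rewrite -gramA.
Qed.

Hypothesis hmin : minimal_on (tangent_umbilical a) A h [set: M].

Lemma trace_shape_operator c p xi : A c -> cdom c p ->
  unit_normal (tangent_umbilical a) A h p xi -> \tr (shape_operator h c p xi) = 0.
Proof.
move=> Ac cp nh; have /eqP := hmin I Ac cp nh.
by rewrite mulf_eq0 invr_eq0 pnatr_eq0 /= => /eqP.
Qed.

Lemma minimal_suspension : minimal_on tangent_H4 B F (regular_point B F).
Proof.
move=> p cc xi; rewrite regular_suspension /= => mu0 [c Ac <-] [/= cp _] nF.
rewrite /mean_curvature shape_operator_suspension // mxtrace_block mxtrace0 addr0.
by rewrite mxtraceZ trace_shape_operator ?mulr0 //; exact: unit_normal_suspension nF.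
Qed.

Lemma zero_gauss_kronecker_suspension :
  zero_gauss_kronecker_on tangent_H4 B F (regular_point B F).
Proof.
move=> p cc xi; rewrite regular_suspension /= => mu0 [c Ac <-] [/= cp _] nF.
have nh := unit_normal_suspension mu0 nF.
have trS := trace_shape_operator Ac cp nh.
have SG : shape_operator h c p.1 xi *m g c p.1 = second_fundamental_form h c p.1 xi.
  rewrite /shape_operator; have -> : induced_metric h c p.1 = g c p.1 by exact: gramA.
  by rewrite mulmxKV // posdef_unitmx //; exact: posA.
(* Symmetry of second derivatives makes the shape operator self-adjoint for [g]; with zero trace,
   its determinant is then nonpositive. *)
have detS : \det (shape_operator h c p.1 xi) <= 0.
  apply: (@traceless_self_adjoint_det _ _ (g c p.1)) => //; [exact: symA | exact: posA |].
  rewrite SG; apply/matrixP => i j; rewrite !mxE -!pdE.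
  by rewrite (pd_sym _ _ (oA Ac) (smA Ac) (imA cp)).
have [||k kE k0] := @traceless_block_eigenvalues R ((mu p.2)^-1 *: shape_operator h c p.1 xi).
- by rewrite mxtraceZ trS mulr0.
- by rewrite detZ mulr_ge0_le0 // exprn_even_ge0.
exists k; last by rewrite k0.
by rewrite /principal_curvatures shape_operator_suspension.
Qed.

End Suspension.

(** * The induced metric of the suspension as a Riemannian metric *)

Section RiemannianSuspension.
Context {R : realType} {M : topologicalType}.
Notation E := 'rV[R]_5.
Variables (A : set (chart R M 2)) (g : metric R M 2) (a : E) (b al : R).
Variables (eta : E -> E) (h : M -> E).
Hypotheses (atlasA : smooth_atlas A) (hg : riemannian A g).
Hypothesis alE : al ^+ 2 * (lorentz a a + b ^+ 2) = 1.
Hypothesis etaE : forall p, eta (h p) = al *: (a + b *: h p).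
Hypothesis hh : isometric_immersion A g (umbilical a b) h.

Let F : M * R -> E := suspension eta h.
Let B := prod_atlas A.
Let mu := warping (al * b).

(** A change of product chart leaves the height unchanged; the block form is what the transformation
    law of the metric on [M * R] needs. *)
Lemma jacobian_prod (c c' : chart R M 2) p : A c -> A c' -> cdom c p.1 -> cdom c' p.1 ->
  jacobian (transition (prod_chart c) (prod_chart c')) (cmap (prod_chart c) p) =
  block_mx (jacobian (transition c c') (cmap c p.1)) 0 0 (1%:M : 'M[R]_1).
Proof.
move=> Ac Ac' cp c'p; have [_ _ tA] := atlasA.
set T := transition (prod_chart c) (prod_chart c'); set y := cmap (prod_chart c) p.
have ly : lsubmx y = cmap c p.1 by rewrite /y row_mxKl.
have dt : differentiable (transition c c') (lsubmx y).
  by rewrite ly; apply: (smooth_on_differentiable (tA c c' Ac Ac')); exists p.1.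
have dtl : differentiable (transition c c' \o lsubmx) y.
  by apply: differentiable_comp => //; exact: differentiable_lsubmx.
have Tl j : (fun z => T z 0 (lshift 1 j)) = (fun z => (transition c c' \o lsubmx) z 0 j).
  by apply: funext => z; rewrite /T /transition /= row_mxEl.
have Tr j : (fun z => T z 0 (rshift 2 j)) = height.
  by apply: funext => z; rewrite /T /transition /= row_mxEr mxE (ord1 j).
have dT : differentiable T y.
  apply: differentiable_mx => i j; rewrite (ord1 i).
  case: (split_ordP j) => {}j ->; first by rewrite Tl; exact: differentiable_entry.
  by rewrite Tr; exact: differentiable_height.
apply/row_matrixP => i; rewrite !rowE mul_rV_lin1 -deriveE //; set u := delta_mx 0 i.
rewrite -[u in RHS]hsubmxK mul_row_block !mulmx0 addr0 add0r mulmx1.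
apply/rowP => j; rewrite derive_entry //.
case: (split_ordP j) => {}j ->.
  rewrite Tl row_mxEl -(derive_entry _ _ _ dtl) derive_comp_linear /= deriveE // ly.
  by rewrite -[in RHS]/(jacobian _ _) mul_rV_lin1.
by rewrite Tr row_mxEr derive_height (ord1 j).
Qed.

Lemma riemannian_suspension : (forall t, mu t != 0) -> riemannian B (induced_metric F).
Proof.
move=> mu0; have [chA covA tA] := atlasA; have [sg pg jg] := hg.
have gF := induced_metric_suspension atlasA alE etaE hh.
split.
- move=> _ [c Ac <-]; have [_ oi invc _ _] := chA c Ac.
  have oW : open (cimage (prod_chart c)) by rewrite cimage_prod; exact: open_cylinder.
  pose H (y : 'rV[R]_(2 + 1)) := block_mx (mu (height y) ^+ 2 *: (g c \o cinv c) (lsubmx y)) 0 0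
     (1%:M : 'M[R]_1).
  apply: (@smooth_on_ext _ _ _ _ H) => //.
    move=> y; rewrite inE cimage_prod /= => -[p cp pE].
    by rewrite gF //= -pE invc.
  have smu : smooth_on (cimage (prod_chart c)) (fun y => mu (height y)).
    have [sc ss] := smooth_on_cosh_sinh oW (smooth_on_height oW).
    by apply: smooth_onD => //; apply: smooth_onM => //; exact: smooth_on_cst.
  apply: smooth_on_mx => // i j; rewrite /H.
  case: (split_ordP i) => {}i ->; case: (split_ordP j) => {}j ->.
  + apply: (@smooth_on_ext _ _ R _ (fun y => mu (height y) * mu (height y) *
        ((g c \o cinv c) \o lsubmx) y i j)) => //.
      by move=> y _; rewrite block_mxEul mxE expr2.
    apply: smooth_onM => //; first exact: smooth_onM.
    apply: smooth_on_entry => //; rewrite cimage_prod; apply: smooth_on_comp_linear.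
      exact: continuous_lsubmx.
    exact: sg.
  + apply: (@smooth_on_ext _ _ R _ (cst 0)) => //; last exact: smooth_on_cst.
    by move=> y _; rewrite block_mxEur mxE.
  + apply: (@smooth_on_ext _ _ R _ (cst 0)) => //; last exact: smooth_on_cst.
    by move=> y _; rewrite block_mxEdl mxE.
  + apply: (@smooth_on_ext _ _ R _ (cst ((1%:M : 'M[R]_1) i j))) => //; last exact: smooth_on_cst.
    by move=> y _; rewrite block_mxEdr.
- move=> _ p [c Ac <-] [/= cp _]; rewrite gF //; have [gT gpos] := pg c p.1 Ac cp.
  split; first by rewrite tr_block_mx linearZ /= gT !trmx0 trmx1.
  move=> v v0; rewrite bilin_block -expr2.
  have [lv0|lv0] := eqVneq (lsubmx v) 0; last first.
    apply: ltr_pwDl; last exact: sqr_ge0.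
    by apply: mulr_gt0; [rewrite exprn_even_gt0 //= mu0 | exact: gpos].
  rewrite lv0 /bilin !mul0mx mxE mulr0 add0r exprn_even_gt0 //=.
  apply: contra_neq v0 => hv.
  by rewrite -(hsubmxK v) lv0 [rsubmx v]mx11_scalar -/(height v) hv raddf0 row_mx0.
- move=> _ _ p [c Ac <-] [c' Ac' <-] [/= cp _] [/= c'p _].
  rewrite /= (jacobian_prod Ac Ac' cp c'p) !gF // (jg c c' p.1) //.
  rewrite tr_block_mx !trmx0 trmx1 !mulmx_block !mulmx0 !mul0mx !addr0 !add0r !mulmx1.
  by rewrite mul0mx -scalemxAr -scalemxAl.
Qed.

End RiemannianSuspension.

(** * Lengths and completeness *)

Section SegmentIntegrals.
Context {R : realType}.
Notation leb := (@lebesgue_measure R).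
Implicit Types (f w : R -> R) (r s t : R).

Lemma segment_integrable f r s : (forall t, r <= t <= s -> {for t, continuous f}) ->
  leb.-integrable `[r, s] (EFin \o f).
Proof.
move=> cf; apply: continuous_compact_integrable; first exact: segment_compact.
apply: continuous_in_subspaceT => t; rewrite inE /= in_itv /= => rts.
exact: cf.
Qed.

Lemma le_segment_integral f w r s : (forall t, r <= t <= s -> {for t, continuous f}) ->
  (forall t, r <= t <= s -> {for t, continuous w}) ->
  (forall t, r <= t <= s -> f t <= w t) ->
  \int[leb]_(t in `[r, s]) f t <= \int[leb]_(t in `[r, s]) w t.
Proof.
move=> cf cw fw; apply: le_Rintegral.
- exact: measurable_itv.
- exact: segment_integrable.
- exact: segment_integrable.
- by move=> t; rewrite /= in_itv /=; exact: fw.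
Qed.

Lemma segment_integral_affine f r s k l : r <= s ->
  (forall t, r <= t <= s -> {for t, continuous f}) ->
  \int[leb]_(t in `[r, s]) (k * f t + l) = k * \int[leb]_(t in `[r, s]) f t + l * (s - r).
Proof.
move=> rs cf; rewrite RintegralD; last 3 first.
- exact: measurable_itv.
- by apply: segment_integrable => t rts; apply: cvgM; [exact: cvg_cst | exact: cf].
- by apply: segment_integrable => t _; exact: cvg_cst.
rewrite RintegralZl; [|exact: measurable_itv|exact: segment_integrable].
rewrite Rintegral_cst; last exact: measurable_itv.
congr (_ + _ * _); rewrite -[RHS]/(fine (s - r)%:E); congr fine.
apply: etrans (lebesgue_measure_itv `[r, s]) _; rewrite /= lte_fin.
by case: ltgtP rs => // -> _; rewrite subrr.
Qed.

(** The fundamental theorem of calculus on [[r, t]], followed by enlarging the domain of integration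
    of the nonnegative [f]. *)
Lemma increment_le_integral f w r s : r <= s -> (forall t, derivable w t 1) ->
  continuous (derive1 w) ->
  (forall t, r <= t <= s -> {for t, continuous f}) ->
  (forall t, r <= t <= s -> `|derive1 w t| <= f t) ->
  forall t, r <= t <= s -> `|w t - w r| <= \int[leb]_(x in `[r, s]) f x.
Proof.
move=> rs dw cw cf wf t /andP[rt ts].
have f0 x : r <= x <= s -> 0 <= f x by move=> /wf; apply: le_trans.
(* [continuous_FTC2] requires a nondegenerate interval. *)
have [->|ne] := eqVneq t r.
  rewrite subrr normr0; apply: Rintegral_ge0 => x; rewrite /= in_itv /=; exact: f0.
have {}rt : r < t by rewrite lt_neqAle eq_sym ne.
have cw0 x : {for x, continuous w}.
  by apply: differentiable_continuous; apply/derivable1_diffP.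
have ftc : (\int[leb]_(x in `[r, t]) (derive1 w x)%:E = (w t)%:E - (w r)%:E)%E.
  apply: (@continuous_FTC2 _ (derive1 w) w r t rt); last by [].
    exact: continuous_subspaceT.
  split=> [x _||]; first exact: dw.
    exact: cvg_at_right_filter (cw0 r).
  exact: cvg_at_left_filter (cw0 t).
have {}ftc : \int[leb]_(x in `[r, t]) derive1 w x = w t - w r by rewrite /Rintegral ftc.
rewrite -ftc; apply: le_trans (le_normr_Rintegral _ _) _.
- exact: measurable_itv.
- by apply: segment_integrable => x _; exact: cw.
have sub x : r <= x <= t -> r <= x <= s by move=> /andP[-> xt]; exact: le_trans xt ts.
apply: (@le_trans _ _ (\int[leb]_(x in `[r, t]) f x)).
  apply: le_segment_integral => x /sub xs; last exact: wf.
    by apply: cvg_norm; exact: cw.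
  exact: cf.
have intf := segment_integrable cf.
apply: fine_le.
- apply: integrable_fin_num; first exact: measurable_itv.
  by apply: segment_integrable => x /sub; exact: cf.
- by apply: integrable_fin_num; [exact: measurable_itv|].
- apply: ge0_subset_integral; [exact: measurable_itv|exact: measurable_itv| | |].
  + by have /integrableP[] := intf.
  + by move=> x; rewrite /= in_itv /= lee_fin; exact: f0.
  + by move=> x; rewrite /= !in_itv /=; exact: sub.
Qed.

End SegmentIntegrals.

Section CurveCalculus.
Context {R : realType}.

Lemma continuous_mx {T : topologicalType} {m n} (f : T -> 'M[R]_(m, n)) t :
  (forall i j, {for t, continuous (fun x => f x i j : R)}) -> {for t, continuous f}.
Proof.
move=> cf; apply/cvgrPdist_le => /= e e0; near=> x.
rewrite /Num.Def.normr/= mx_normrE (bigmax_le _ (ltW e0))//= => i _.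
rewrite !mxE; move: i; near: x; apply: filter_forall => /= i.
exact: ((cvgrPdist_le _ _).1 (cf i.1 i.2)).
Unshelve. all: by end_near. Qed.

Lemma continuous_entry {T : topologicalType} {m n} (f : T -> 'M[R]_(m, n)) t i j :
  {for t, continuous f} -> {for t, continuous (fun x => f x i j : R)}.
Proof.
move=> cf; apply: (@continuous_comp _ _ _ f (fun N : 'M[R]_(m, n) => N i j : R)) => //.
exact: coord_continuous.
Qed.

Lemma continuous_sum {T : topologicalType} n (f : 'I_n -> T -> R) t :
  (forall i, {for t, continuous (f i)}) -> {for t, continuous (fun x => \sum_i f i x : R)}.
Proof.
by move=> cf; apply: cvg_big => [|i _]; [exact: add_continuous | exact: cf].
Qed.

Lemma C1_entry n (u : R -> 'rV[R]_n) j : C1 u ->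
  (forall t, derivable (fun x => u x 0 j : R) t 1) /\
  derive1 (fun x => u x 0 j : R) = (fun t => derive1 u t 0 j).
Proof.
move=> [du _]; have dj t : differentiable u t by apply/derivable1_diffP.
split=> [t|]; first by apply/derivable1_diffP; exact: differentiable_entry.
by apply: funext => t; rewrite !derive1E derive_entry.
Qed.

Lemma C1_mx n (u : R -> 'rV[R]_n) (u' : R -> 'rV[R]_n) :
  (forall (t : R) j, is_derive t 1 (fun x => u x 0 j : R) (u' t 0 j)) ->
  (forall j, continuous (fun t => u' t 0 j : R)) -> C1 u /\ derive1 u = u'.
Proof.
move=> du cu.
have dd t : differentiable u t.
  apply: differentiable_mx => i j; rewrite (ord1 i); apply/derivable1_diffP.
  exact: (@ex_derive _ _ _ _ _ _ _ (du t j)).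
have uE : derive1 u = u'.
  apply: funext => t; rewrite derive1E; apply/rowP => j; rewrite derive_entry //.
  exact: derive_val.
split=> //; split=> [t|]; first by apply/derivable1_diffP.
by rewrite uE => t; apply: continuous_mx => i j; rewrite (ord1 i); exact: cu.
Qed.

Lemma C1_lsubmx n (u : R -> 'rV[R]_(n + 1)) : C1 u ->
  C1 (lsubmx \o u) /\ derive1 (lsubmx \o u) = lsubmx \o derive1 u.
Proof.
move=> Cu; apply: C1_mx => [t j|j].
  have [/(_ t) /derivableP dj eu] := C1_entry (lshift 1 j) Cu.
  rewrite (_ : (fun x => _) = (fun x => u x 0 (lshift 1 j))); last first.
    by apply: funext => x; rewrite /= mxE.
  apply: (is_derive_eq dj).
  by rewrite -derive1E eu /= mxE.
rewrite (_ : (fun x => _) = (fun x => derive1 u x 0 (lshift 1 j))); last first.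
  by apply: funext => x; rewrite /= mxE.
by move=> t; apply: continuous_entry; have [_] := Cu; apply.
Qed.

Lemma C1_height n (u : R -> 'rV[R]_(n + 1)) : C1 u ->
  [/\ forall t, derivable (height \o u) t 1,
      derive1 (height \o u) = height \o derive1 u & continuous (derive1 (height \o u))].
Proof.
move=> Cu; have [dh hE] := C1_entry (rshift n 0) Cu.
have heE (w : R -> 'rV[R]_(n + 1)) : height \o w = fun x => w x 0 (rshift n 0).
  by apply: funext => x; rewrite /= /height mxE.
rewrite !heE hE; split=> // t.
by apply: continuous_entry; have [_] := Cu; apply.
Qed.

Lemma C1_row_affine n (u : R -> 'rV[R]_n) k v : C1 u ->
  C1 (fun s => row_mx (u s) (k + v * s)%:M : 'rV[R]_(n + 1)) /\
  derive1 (fun s => row_mx (u s) (k + v * s)%:M : 'rV[R]_(n + 1)) =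
  (fun s => row_mx (derive1 u s) v%:M).
Proof.
move=> Cu; apply: C1_mx => [t j|j]; case: (split_ordP j) => {}j ->.
- have [/(_ t) /derivableP dj eu] := C1_entry j Cu.
  rewrite (_ : (fun x => _) = (fun x => u x 0 j)); last first.
    by apply: funext => x; rewrite row_mxEl.
  apply: (is_derive_eq dj).
  by rewrite -derive1E eu row_mxEl.
- rewrite (_ : (fun x => _) = (cst k + v *: (id : R -> R))); last first.
    by apply: funext => x; rewrite row_mxEr mxE (ord1 j).
  apply: (is_derive_eq (is_deriveD (is_derive_cst k t 1) (is_deriveZ v (is_derive_id t 1)))).
  by rewrite row_mxEr mxE (ord1 j) add0r [LHS]mulr1.
- rewrite (_ : (fun x => _) = (fun x => derive1 u x 0 j)); last first.
    by apply: funext => x; rewrite row_mxEl.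
  by move=> t; apply: continuous_entry; have [_] := Cu; apply.
rewrite (_ : (fun x => _) = cst v); first exact: cst_continuous.
by apply: funext => x; rewrite row_mxEr mxE (ord1 j).
Qed.

End CurveCalculus.

Section Speed.
Context {R : realType} {M : topologicalType} {n : nat}.
Variables (A : set (chart R M n)) (g : metric R M n).
Hypothesis hg : riemannian A g.
Notation leb := (@lebesgue_measure R).

(** The integrand of [curve_length] evaluates the metric at [gam t], about which nothing is known
    off the piece. Recovering the point from [u] gives a function continuous at every point of the
    closed piece, endpoints included. *)
Definition speed (c : chart R M n) (u : R -> 'rV[R]_n) (t : R) : R :=
  Num.sqrt (bilin (g c (cinv c (u t))) (derive1 u t) (derive1 u t)).

Lemma continuous_speed c u t : A c -> open (cimage c) -> C1 u -> cimage c (u t) ->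
  {for t, continuous (speed c u)}.
Proof.
move=> Ac oc [du cu] ut; have [sg _ _] := hg.
have cut : {for t, continuous u}.
  by apply: differentiable_continuous; apply/derivable1_diffP.
apply: (@continuous_comp _ _ _
    (fun s => bilin (g c (cinv c (u s))) (derive1 u s) (derive1 u s)) Num.sqrt);
  last exact: sqrt_continuous.
rewrite (_ : (fun s => _) = (fun s => \sum_i \sum_j derive1 u s 0 i * (g c \o cinv c) (u s) i j
   * derive1 u s 0 j)); last by apply: funext => s; rewrite bilinE.
apply: continuous_sum => i; apply: continuous_sum => j.
have ce k : {for t, continuous (fun s => derive1 u s 0 k : R)}.
  by apply: continuous_entry; exact: cu.
apply: cvgM; last exact: ce; apply: cvgM; first exact: ce.
apply: (@continuous_comp _ _ _ u (fun x => (g c \o cinv c) x i j : R)) => //.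
apply: continuous_entry; apply: differentiable_continuous.
exact: (smooth_on_differentiable (sg c Ac)).
Qed.

Lemma length_speed c u (gam : R -> M) r s :
  (forall p, cdom c p -> cinv c (cmap c p) = p) ->
  (forall t, r <= t <= s -> cdom c (gam t) /\ cmap c (gam t) = u t) ->
  \int[leb]_(t in `[r, s]) Num.sqrt (bilin (g c (gam t)) (derive1 u t) (derive1 u t)) =
  \int[leb]_(t in `[r, s]) speed c u t.
Proof.
move=> ic gu; apply: eq_Rintegral => t; rewrite inE /= in_itv /= => /gu[ct gt].
by rewrite /speed -gt ic.
Qed.

Lemma curve_length_ge0 gam r s L : curve_length A g gam r s L -> r <= s /\ 0 <= L.
Proof.
elim=> {r s L} [r|r s s' c u L rs Ac Cu gu _ [ss' L0]]; first by split.
split; first exact: le_trans (ltW rs) ss'.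
by apply: addr_ge0 => //; apply: Rintegral_ge0 => t _; exact: sqrtr_ge0.
Qed.

Lemma riemannian_distance_lt p q e : (riemannian_distance A g p q < e%:E)%E ->
  exists (gam : R -> M) (r s L : R),
    [/\ gam r = p, gam s = q, curve_length A g gam r s L & L < e].
Proof.
move=> /ereal_inf_lt[_ [L [gam [r [s [gr gs cl]]]] <-]].
by rewrite lte_fin => Le; exists gam, r, s, L.
Qed.

Lemma curve_length_distance gam r s L e : curve_length A g gam r s L -> L < e ->
  (riemannian_distance A g (gam r) (gam s) < e%:E)%E.
Proof.
move=> cl Le; apply: (@le_lt_trans _ _ L%:E); last by rewrite lte_fin.
by apply: ereal_inf_lbound; exists L => //; exists gam, r, s.
Qed.

(** A curve on a one-point interval is replaced by a constant curve on [[0, 1]], because lifting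
    with prescribed end heights divides by [s - r]. *)
Lemma riemannian_distance_lt_itv p q e : (forall x, exists2 c, A c & cdom c x) ->
  (riemannian_distance A g p q < e%:E)%E ->
  exists (gam : R -> M) (r s L : R),
    [/\ gam r = p, gam s = q, curve_length A g gam r s L, L < e & r < s].
Proof.
move=> covA /riemannian_distance_lt[gam [r [s [L [gr gs cl Le]]]]].
have [rs L0] := curve_length_ge0 cl.
move: rs; rewrite le_eqVlt => /predU1P[rs|rs]; last by exists gam, r, s, L.
have [c Ac cp] := covA p.
have qp : q = p by rewrite -gr -gs rs.
have d0 : derive1 (cst (cmap c p) : R -> 'rV[R]_n) = cst 0.
  by apply: funext => t; rewrite derive1_cst.
have C1p : C1 (cst (cmap c p) : R -> 'rV[R]_n).
  by split=> [t|]; [exact: derivable_cst | rewrite d0; exact: cst_continuous].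
have cl0 := curve_length_cons ltr01 Ac C1p
  (fun t _ => conj cp (erefl (cmap c p))) (curve_length_nil A g (cst p) 1).
exists (cst p), 0, 1, 0; split=> //; last exact: le_lt_trans Le.
move: cl0; rewrite addr0 d0 (@eq_Rintegral _ _ _ _ _ (cst 0)).
  by rewrite Rintegral_cst ?mul0r //; exact: measurable_itv.
by move=> t _; rewrite /bilin !mul0mx mxE sqrtr0.
Qed.

End Speed.

(** * Lengths of curves in a warped product *)

Section WarpedProductCurves.
Context {R : realType} {M : topologicalType} {n : nat}.
Variables (A : set (chart R M n)) (g : metric R M n) (mu : R -> R).
Variable gF : metric R (M * R)%type (n + 1).
Let B := prod_atlas A.
Hypotheses (atlasA : smooth_atlas A) (hg : riemannian A g) (hgF : riemannian B gF).
Hypothesis gFE : forall c p, A c -> cdom c p.1 ->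
  gF (prod_chart c) p = block_mx (mu p.2 ^+ 2 *: g c p.1) 0 0 1%:M.
Notation leb := (@lebesgue_measure R).

Let oA c : A c -> open (cimage c).
Proof. by move=> Ac; have [cA _ _] := atlasA; have [] := cA c Ac. Qed.

Let invA c p : A c -> cdom c p -> cinv c (cmap c p) = p.
Proof. by move=> Ac cp; have [cA _ _] := atlasA; have [_ _ ic _ _] := cA c Ac; exact: ic. Qed.

Let oB c : A c -> open (cimage (prod_chart c)).
Proof. by move=> Ac; rewrite cimage_prod; apply: open_cylinder; exact: oA. Qed.

Let invB c p : A c -> cdom (prod_chart c) p -> cinv (prod_chart c) (cmap (prod_chart c) p) = p.
Proof.
by move=> Ac [cp _]; case: p cp => p t /= cp; rewrite row_mxKl invA // row_mxKr mxE eqxx.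
Qed.

Let speed_prod c u t : A c -> cimage c (lsubmx (u t)) ->
  speed gF (prod_chart c) u t = Num.sqrt (mu (height (u t)) ^+ 2 *
    bilin (g c (cinv c (lsubmx (u t)))) (lsubmx (derive1 u t)) (lsubmx (derive1 u t))
    + height (derive1 u t) ^+ 2).
Proof.
move=> Ac [p cp pu]; rewrite /speed gFE //=; last by rewrite -pu invA.
by rewrite bilin_block expr2.
Qed.

Let bilin_ge0 c x v : A c -> cimage c x -> 0 <= bilin (g c (cinv c x)) v v.
Proof.
move=> Ac [p cp <-]; rewrite invA //; apply: posdef_ge0.
by have [_ gp _] := hg; have [] := gp c p Ac cp.
Qed.

Let piece (c : chart R M n) (gam : R -> M * R) u t :
  cdom (prod_chart c) (gam t) /\ cmap (prod_chart c) (gam t) = u t ->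
  [/\ cdom c (gam t).1, cmap c (gam t).1 = lsubmx (u t), (gam t).2 = height (u t),
     cimage c (lsubmx (u t)) & cimage (prod_chart c) (u t)].
Proof.
move=> [cg <-]; have [c1 _] := cg.
rewrite /= row_mxKl /height row_mxKr mxE eqxx; split => //; first by exists (gam t).1.
by exists (gam t).
Qed.

(** The speed dominates the height component, as [mu^2 g] is nonnegative. The bound covers all
    times, not only the endpoint, since it also has to confine a short curve to a band of
    heights. *)
Lemma curve_height_bound gam r s L : curve_length B gF gam r s L ->
  forall t, r <= t <= s -> `|(gam t).2 - (gam r).2| <= L.
Proof.
elim=> {r s L} [r t /le_anti ->|r s s' _ u L rs [c Ac <-] Cu gu cl IH t /andP[rt ts']].
  by rewrite subrr normr0.
have [ss' L0] := curve_length_ge0 cl.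
have csp x : r <= x <= s -> {for x, continuous (speed gF (prod_chart c) u)}.
  move=> rxs; have [_ _ _ _ ix] := piece (gu x rxs); apply: (continuous_speed hgF) => //; last exact: oB.
  by exists c.
have step x : r <= x <= s -> `|(gam x).2 - (gam r).2| <=
    \int[leb]_(t in `[r, s]) speed gF (prod_chart c) u t.
  move=> rxs; have [dh hE ch] := C1_height Cu.
  have rr : r <= r <= s by rewrite lexx ltW.
  have [_ _ -> _ _] := piece (gu x rxs); have [_ _ -> _ _] := piece (gu r rr).
  apply: (increment_le_integral (ltW rs) dh ch csp) => // y rys.
  have [_ _ _ iy _] := piece (gu y rys).
  rewrite hE speed_prod // -sqrtr_sqr ler_sqrt.
    by rewrite lerDr mulr_ge0 ?sqr_ge0 // bilin_ge0.
  by rewrite addr_ge0 ?sqr_ge0 // mulr_ge0 ?sqr_ge0 // bilin_ge0.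
rewrite (length_speed _ (fun p => @invB c p Ac) gu).
have [ts|st] := leP t s.
  by apply: (le_trans (step t _)); [rewrite rt ts | rewrite lerDl].
apply: (le_trans (ler_distD (gam s).2 _ _)); rewrite addrC lerD //.
  by apply: step; rewrite lexx ltW.
by apply: IH; rewrite ltW.
Qed.

(** Where [mu >= m], the speed dominates [m] times the speed of the projection, the height component
    only adding to it. *)
Lemma curve_projection gam r s L m : 0 <= m -> curve_length B gF gam r s L ->
  (forall t, r <= t <= s -> m <= mu (gam t).2) ->
  exists2 L', curve_length A g (fun t => (gam t).1) r s L' & m * L' <= L.
Proof.
move=> m0; elim=> {r s L} [r _|r s s' _ u L rs [c Ac <-] Cu gu cl IH hm].
  by exists 0; [exact: curve_length_nil | rewrite mulr0].
have [ss' L0] := curve_length_ge0 cl.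
have [|L' cl' mL'] := IH.
  by move=> t /andP[st ts']; apply: hm; rewrite ts' (le_trans (ltW rs)).
have [Cl lE] := C1_lsubmx Cu.
have gl t : r <= t <= s -> cdom c (gam t).1 /\ cmap c (gam t).1 = (lsubmx \o u) t.
  by move=> rts; have [] := piece (gu t rts).
exists (\int[leb]_(t in `[r, s]) Num.sqrt (bilin (g c (gam t).1)
   (derive1 (lsubmx \o u) t) (derive1 (lsubmx \o u) t)) + L').
  exact: curve_length_cons Ac Cl gl cl'.
rewrite mulrDr lerD //.
rewrite (@length_speed _ _ _ g c _ (fun t => (gam t).1) _ _ (fun p => @invA c p Ac) gl).
rewrite (length_speed _ (fun p => @invB c p Ac) gu).
have csA x : r <= x <= s -> {for x, continuous (speed g c (lsubmx \o u))}.
  by move=> rxs; have [_ _ _ ix _] := piece (gu x rxs); apply: (continuous_speed hg) => //; exact: oA.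
have csB x : r <= x <= s -> {for x, continuous (speed gF (prod_chart c) u)}.
  move=> rxs; have [_ _ _ _ ix] := piece (gu x rxs); apply: (continuous_speed hgF) => //; last exact: oB.
  by exists c.
have -> : m * \int[leb]_(t in `[r, s]) speed g c (lsubmx \o u) t =
   \int[leb]_(t in `[r, s]) (m * speed g c (lsubmx \o u) t + 0).
  by rewrite segment_integral_affine ?ltW // mul0r addr0.
apply: le_segment_integral => // x rxs.
  by apply: cvgD; [apply: cvgM; [exact: cvg_cst | exact: csA] | exact: cvg_cst].
have [_ _ ge ix _] := piece (gu x rxs).
have mx : m <= mu (height (u x)).
  by rewrite -ge; apply: hm; have /andP[-> xs] := rxs; exact: le_trans xs ss'.
rewrite addr0 speed_prod // /speed lE /= -{1}(ger0_norm m0) -sqrtr_sqr -sqrtrM ?sqr_ge0 //.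
have b0 := bilin_ge0 (lsubmx (derive1 u x)) Ac ix.
have mm : m ^+ 2 <= mu (height (u x)) ^+ 2 by rewrite ler_sqr ?nnegrE // (le_trans m0).
rewrite ler_sqrt; last by rewrite addr_ge0 ?sqr_ge0 // mulr_ge0 // sqr_ge0.
by apply: (le_trans (ler_wpM2r b0 mm)); rewrite lerDl sqr_ge0.
Qed.

(** The height is affine in the parameter, so it moves at the constant rate [v], and
    [sqrt (x^2 + y^2) <= x + |y|] for [x >= 0] bounds the speed of the lift. *)
Lemma curve_lift gam r s L k v m : curve_length A g gam r s L ->
  (forall t, r <= t <= s -> `|mu (k + v * t)| <= m) ->
  exists2 L', curve_length B gF (fun t => (gam t, k + v * t)) r s L' &
    L' <= m * L + `|v| * (s - r).
Proof.
elim=> {r s L} [r _|r s s' c u L rs Ac Cu gu cl IH hm].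
  by exists 0; [exact: curve_length_nil | rewrite subrr !mulr0 addr0].
have [ss' L0] := curve_length_ge0 cl.
have [|L' cl' mL'] := IH.
  by move=> t /andP[st ts']; apply: hm; rewrite ts' (le_trans (ltW rs)).
have [Cl lE] := C1_row_affine k v Cu.
set w := fun t => row_mx (u t) (k + v * t)%:M; rewrite -/w in Cl lE.
have gl t : r <= t <= s -> cdom (prod_chart c) (gam t, k + v * t) /\
    cmap (prod_chart c) (gam t, k + v * t) = w t.
  by move=> /gu[ct gt]; split=> //=; rewrite gt.
exists (\int[leb]_(t in `[r, s]) Num.sqrt (bilin (gF (prod_chart c) (gam t, k + v * t))
   (derive1 w t) (derive1 w t)) + L').
  by apply: curve_length_cons gl cl' => //; exists c.
rewrite (length_speed g (fun p => @invA c p Ac) gu).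
rewrite (@length_speed _ _ _ gF (prod_chart c) _ (fun t => (gam t, k + v * t)) _ _
  (fun p => @invB c p Ac) gl).
have gi x : r <= x <= s -> cimage c (u x) by move=> /gu[cx <-]; exists (gam x).
have csA x : r <= x <= s -> {for x, continuous (speed g c u)}.
  by move=> rxs; apply: (continuous_speed hg) => //; [exact: oA | exact: gi].
have csB x : r <= x <= s -> {for x, continuous (speed gF (prod_chart c) w)}.
  move=> rxs; apply: (continuous_speed hgF) => //; [by exists c | exact: oB |].
  by have [cg <-] := gl x rxs; exists (gam x, k + v * x).
apply: (@le_trans _ _ (\int[leb]_(t in `[r, s]) (m * speed g c u t + `|v|) + L')).
  rewrite lerD2r; apply: le_segment_integral => // x rxs.
    by apply: cvgD; [apply: cvgM; [exact: cvg_cst | exact: csA] | exact: cvg_cst].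
  have lw : lsubmx (w x) = u x by rewrite row_mxKl.
  have hw : height (w x) = k + v * x by rewrite /height row_mxKr mxE eqxx.
  have ix := gi x rxs.
  rewrite speed_prod ?lw // hw lE row_mxKl /height row_mxKr mxE eqxx mulr1n.
  have mk : `|mu (k + v * x)| <= m.
    by apply: hm; have /andP[-> xs] := rxs; exact: le_trans xs ss'.
  have m0 : 0 <= m := le_trans (normr_ge0 _) mk.
  have b0 := bilin_ge0 (derive1 u x) Ac ix.
  rewrite /speed; set q := bilin _ _ _ in b0 *.
  have q0 := sqrtr_ge0 q.
  rewrite -[leRHS]ger0_norm; last by rewrite addr_ge0 // mulr_ge0.
  rewrite -sqrtr_sqr ler_sqrt ?sqr_ge0 // sqrrD exprMn sqr_sqrtr // real_normK ?num_real //.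
  rewrite lerD2r ler_wpDr //; first by rewrite mulrn_wge0 // !mulr_ge0.
  by rewrite ler_wpM2r // -real_normK ?num_real // ler_sqr ?nnegrE.
rewrite (segment_integral_affine _ _ (ltW rs) csA); apply: (le_trans (lerD (lexx _) mL')).
rewrite le_eqVlt; apply/orP; left; apply/eqP.
by move: (\int[leb]_(_ in _) _) => I; ring.
Qed.

End WarpedProductCurves.

Lemma real_cauchy_cvg {R : realType} (t : nat -> R) :
  (forall e, 0 < e -> exists N, forall i j, (N <= i)%N -> (N <= j)%N -> `|t i - t j| < e) ->
  exists l, forall e, 0 < e -> exists N, forall i, (N <= i)%N -> `|t i - l| < e.
Proof.
move=> ct; have : cvg (t @ \oo).
  apply/cauchy_cvgP/cauchy_ballP => e e0; have [N hN] := ct e e0.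
  exists ([set x | exists2 i, (N <= i)%N & x = t i], [set x | exists2 i, (N <= i)%N & x = t i]).
    by split; exists N => //= i Ni; exists i.
  by move=> [x y] /= [[i Ni ->] [j Nj ->]]; rewrite -ball_normE /=; exact: hN.
move=> /cvg_ex[l /= /cvgrPdist_lt cl]; exists l => e e0.
by have [N _ hN] := cl e e0; exists N => i Ni; rewrite distrC; exact: hN.
Qed.

Lemma segment_bounds {R : realType} (f : R -> R) T : 0 <= T -> continuous f ->
  (forall t, 0 < f t) ->
  exists m1 m2, [/\ 0 < m1, 0 < m2 & forall t, `|t| <= T -> m1 <= f t <= m2].
Proof.
move=> T0 cf f0; have TT : - T <= T by rewrite -subr_ge0 opprK addr_ge0.
have cfT : {within `[- T, T], continuous f} by exact: continuous_subspaceT.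
have [c1 _ h1] := EVT_min TT cfT; have [c2 _ h2] := EVT_max TT cfT.
exists (f c1), (f c2); split=> // t tT.
by rewrite h1 ?h2 // in_itv /= -ler_norml.
Qed.

(** * Transfer of completeness between the base and a warped product *)

Section WarpedProductCompleteness.
Context {R : realType} {M : topologicalType} {n : nat}.
Variables (A : set (chart R M n)) (g : metric R M n) (mu : R -> R).
Variable gF : metric R (M * R)%type (n + 1).
Let B := prod_atlas A.
Hypotheses (atlasA : smooth_atlas A) (hg : riemannian A g) (hgF : riemannian B gF).
Hypothesis gFE : forall c p, A c -> cdom c p.1 ->
  gF (prod_chart c) p = block_mx (mu p.2 ^+ 2 *: g c p.1) 0 0 1%:M.
Hypotheses (mu_cont : continuous mu) (mu_gt0 : forall t, 0 < mu t).

Let covA x : exists2 c, A c & cdom c x. Proof. by have [_ cA _] := atlasA. Qed.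

Lemma distance_height p q e : (riemannian_distance B gF p q < e%:E)%E -> `|p.2 - q.2| < e.
Proof.
move=> /riemannian_distance_lt[gam [r [s [L [<- <- cl Le]]]]].
have [rs _] := curve_length_ge0 cl.
rewrite distrC; apply: le_lt_trans Le.
by apply: (curve_height_bound atlasA hg hgF gFE cl); rewrite rs lexx.
Qed.

(** A curve of length below [e'] that starts in the band [|t| <= T] stays in [|t| <= T + e'], where
    [mu >= m] and the projection multiplies lengths by at most [1 / m]. *)
Lemma distance_base p q T m e e' : 0 < m -> (forall t, `|t| <= T + e' -> m <= mu t) ->
  `|p.2| <= T -> (riemannian_distance B gF p q < e'%:E)%E -> e' <= m * e ->
  (riemannian_distance A g p.1 q.1 < e%:E)%E.
Proof.
move=> m0 hm pT /riemannian_distance_lt[gam [r [s [L [gp gq cl Le]]]]] em.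
have [|L' cl' mL] := curve_projection atlasA hg hgF gFE (ltW m0) cl (m := m).
  move=> t rts; apply: hm; rewrite -(subrK (gam r).2 (gam t).2).
  apply: (le_trans (ler_normD _ _)); rewrite addrC lerD //; first by rewrite gp.
  exact: le_trans (curve_height_bound atlasA hg hgF gFE cl rts) (ltW Le).
rewrite -gp -gq; apply: (curve_length_distance cl').
by rewrite -(ltr_pM2l m0); apply: le_lt_trans mL _; exact: lt_le_trans Le em.
Qed.

Lemma distance_lift p q k l T m e : (forall t, `|t| <= T -> mu t <= m) ->
  `|k| <= T -> `|l| <= T -> 0 < m -> (riemannian_distance A g p q < e%:E)%E ->
  (riemannian_distance B gF (p, k) (q, l) < (m * e + `|l - k|)%:E)%E.
Proof.
move=> hm kT lT m0 /(riemannian_distance_lt_itv covA)[gam [r [s [L [gp gq cl Le rs]]]]].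
have sr0 : 0 < s - r by rewrite subr_gt0.
(* The affine height with value [k] at [r] and [l] at [s]. *)
pose v := (l - k) / (s - r); pose k0 := k - v * r.
have kE : k0 + v * r = k by rewrite /k0 subrK.
have lE : k0 + v * s = l.
  by rewrite /k0 /v; field; rewrite gt_eqF.
have [|L' cl' L'e] := curve_lift atlasA hg hgF gFE (k := k0) (v := v) (m := m) cl.
  move=> t /andP[rt ts]; rewrite gtr0_norm //; apply: hm.
  (* The height is a convex combination of [k] and [l], hence bounded by [T]. *)
  have -> : k0 + v * t = ((s - t) * k + (t - r) * l) / (s - r).
    by rewrite /k0 /v; field; rewrite gt_eqF.
  rewrite normrM normfV (gtr0_norm sr0) ler_pdivrMr //.
  apply: (le_trans (ler_normD _ _)); rewrite !normrM.
  rewrite (@ger0_norm _ (s - t)) ?subr_ge0 // (@ger0_norm _ (t - r)) ?subr_ge0 //.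
  have -> : T * (s - r) = (s - t) * T + (t - r) * T by ring.
  by apply: lerD; apply: ler_wpM2l; rewrite ?subr_ge0.
have := curve_length_distance cl'; rewrite gp gq kE lE; apply.
apply: le_lt_trans L'e _; rewrite /v normrM normfV (gtr0_norm sr0) divfK ?gt_eqF //.
by rewrite ltrD2r ltr_pM2l.
Qed.

(** The slice at height 0 carries the metric of [M], as [mu 0 = 1], so a Cauchy sequence of [M]
    placed there remains Cauchy, and its limit is projected back. *)
Lemma complete_base : mu 0 = 1 -> complete B gF -> complete A g.
Proof.
move=> mu01 cB d u cu.
have [m1 [m2 [m10 m20 mb]]] := segment_bounds (ler01 : 0 <= 1 :> R) mu_cont mu_gt0.
have [|[p t] hp] := cB (fun i => (u i, 0)).
  move=> e e0; have [N hN] := cu e e0; exists N => i j Ni Nj.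
  have := @distance_lift (u i) (u j) 0 0 0 1 e; rewrite subrr normr0 addr0 mul1r; apply => //.
    by move=> t; rewrite normr_le0 => /eqP ->; rewrite mu01.
  exact: hN.
(* Capping the distance by 1 keeps the curves in the band [|t| <= 1], where [m1] bounds [mu]
   below. *)
exists p => e e0; have [|N hN] := hp (Num.min 1 (m1 * e)).
  by rewrite lt_min ltr01 mulr_gt0.
exists N => i Ni.
apply: (@distance_base (u i, 0) (p, t) 0 m1 e (Num.min 1 (m1 * e))) => //.
- move=> x; rewrite add0r => xm; have /mb/andP[//] : `|x| <= 1.
  by apply: le_trans xm _; rewrite ge_min lexx.
- by rewrite normr0.
- exact: hN.
- by rewrite ge_min lexx orbT.
Qed.

(** Distances dominate height differences, so the heights converge and are eventually confined to a
    band on which [mu] is bounded on both sides. There the base points are Cauchy as well, and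
    affine lifts show convergence to the pair of limits. *)
Lemma complete_warped : complete A g -> complete B gF.
Proof.
move=> cA d w cw.
have [|l hl] := @real_cauchy_cvg _ (fun i => (w i).2).
  move=> e e0; have [N hN] := cw e e0; exists N => i j Ni Nj.
  by apply: distance_height; exact: hN.
have [N0 hN0] := hl 1 ltr01.
pose T := `|l| + 1.
have T0 : 0 <= T by rewrite addr_ge0.
have wT i : (N0 <= i)%N -> `|(w i).2| <= T.
  move=> Ni; rewrite -(subrK l (w i).2); apply: (le_trans (ler_normD _ _)).
  by rewrite /T addrC lerD // ltW // hN0.
have lT : `|l| <= T by rewrite lerDl.
(* The margin 1 beyond [T] leaves room for curves of length below 1. *)
have [m1 [m2 [m10 m20 mb]]] := segment_bounds (addr_ge0 T0 ler01) mu_cont mu_gt0.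
have [|p hp] := cA (fun i => (w i).1).
  move=> e e0; have [|N hN] := cw (Num.min 1 (m1 * e)).
    by rewrite lt_min ltr01 mulr_gt0.
  exists (maxn N0 N) => i j; rewrite !geq_max => /andP[N0i Ni] /andP[N0j Nj].
  apply: (@distance_base (w i) (w j) T m1 e (Num.min 1 (m1 * e))) => //.
  - move=> x xm; have /mb/andP[//] : `|x| <= T + 1.
    by apply: le_trans xm _; rewrite lerD2l ge_min lexx.
  - exact: wT.
  - exact: hN.
  - by rewrite ge_min lexx orbT.
exists (p, l) => e e0.
(* The lift costs [m2] times the base distance plus the height gap; each gets half of [e]. *)
have [|N1 hN1] := hp (e / 2 / m2); first by rewrite !divr_gt0.
have [|N2 hN2] := hl (e / 2); first by rewrite divr_gt0.
exists (maxn N0 (maxn N1 N2)) => i; rewrite !geq_max => /and3P[N0i N1i N2i].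
have hm x : `|x| <= T -> mu x <= m2.
  by move=> xT; have /mb/andP[] : `|x| <= T + 1 by rewrite (le_trans xT) // lerDl.
have := distance_lift hm (wT i N0i) lT m20 (hN1 i N1i).
rewrite -surjective_pairing => /lt_trans; apply.
rewrite lte_fin mulrC divfK ?gt_eqF // distrC.
by have := hN2 i N2i; lra.
Qed.

End WarpedProductCompleteness.

(** * Zeros of the warping function and the sign of the curvature *)

Section WarpingSign.
Context {R : realType}.
Notation E := 'rV[R]_5.

Lemma warping0 (be : R) : warping be 0 = 1.
Proof. by rewrite /warping /cosh /sinh oppr0 expR0; field. Qed.

(* For [be ^ 2 > 1] the warping function vanishes where [tanh t = - 1 / be]. *)
Lemma warping_neq0_le1 (be : R) : (forall t, warping be t != 0) -> be ^+ 2 <= 1.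
Proof.
move=> w0; rewrite leNgt; apply/negP => be1.
have x0 : 0 < (be - 1) / (be + 1).
  have -> : (be - 1) / (be + 1) = (be ^+ 2 - 1) / (be + 1) ^+ 2.
    by field; apply/eqP => e; move: be1; nra.
  by apply: divr_gt0; [lra | rewrite exprn_even_gt0 //=; apply/eqP => e; nra].
have b10 : be + 1 != 0 by apply/eqP => e; nra.
have := w0 (2^-1 * ln ((be - 1) / (be + 1))); set t := _ * _.
have et : expR t * expR t = (be - 1) / (be + 1).
  by rewrite -expRD -mulr2n -mulr_natl /t mulrA divff ?mul1r ?lnK ?pnatr_eq0.
have := expRxMexpNx_1 t; rewrite /warping /cosh /sinh.
move: (expR t) (expR (- t)) et => u v uu uv /negP; apply; apply/eqP.
have u0 : u != 0 by apply/eqP => u0; move: uv; rewrite u0 mul0r => /esym/eqP; rewrite oner_eq0.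
apply: (mulfI u0); rewrite mulr0.
transitivity ((u * u * (be + 1) + (u * v) * (1 - be)) / 2); first by field.
by rewrite uu uv; field.
Qed.

Variables (a : E) (b al : R).
Hypothesis hQ : umbilical_hypersurface a b.
Hypothesis alE : al ^+ 2 * (lorentz a a + b ^+ 2) = 1.

Lemma umbilical_curvature_warping : umbilical_curvature a b = (al * b) ^+ 2 - 1.
Proof.
have D0 := umbilical_discr_gt0 hQ; rewrite /umbilical_curvature.
move: (lorentz a a) alE D0 => q e D0; apply: (canLR (mulfK _)); first by rewrite gt_eqF.
have -> : ((al * b) ^+ 2 - 1) * (q + b ^+ 2) = b ^+ 2 * (al ^+ 2 * (q + b ^+ 2)) - q - b ^+ 2 by ring.
by rewrite e; ring.
Qed.

Lemma constant_curvature_umbilical : constant_curvature (umbilical a b) (umbilical_curvature a b).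
Proof.
move=> U phi oU sphi hphi x v w Ux vw.
exact: (umbilical_sectional_curvature hQ oU sphi hphi Ux vw).
Qed.

(** Evaluating at the origin of the explicit parametrization, on the plane of the first two
    coordinate vectors, pins [K] down. *)
Lemma constant_curvature_umbilical_unique K :
  constant_curvature (umbilical a b) K -> K = umbilical_curvature a b.
Proof.
have [U [phi [oU U0 sphi hphi]]] := umbilical_parametrization hQ.
have vw : row_free (col_mx (delta_mx 0 0) (delta_mx 0 1) : 'M[R]_(1 + 1, 3)).
  apply: inj_row_free => u; rewrite -(hsubmxK u) mul_row_col.
  rewrite [lsubmx u]mx11_scalar [rsubmx u]mx11_scalar !mul_scalar_mx => /rowP e.
  have := e 0; have := e 1; rewrite !mxE /= !mulr1 !mulr0 addr0 add0r => -> ->.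
  by rewrite raddf0 row_mx0.
move=> /(_ U phi oU sphi hphi 0 _ _ U0 vw) <-.
by rewrite (umbilical_sectional_curvature hQ oU sphi hphi U0 vw).
Qed.

Lemma horosphere_or_equidistantE :
  (horosphere (umbilical a b) \/ equidistant (umbilical a b)) <-> (al * b) ^+ 2 <= 1.
Proof.
rewrite -subr_le0 -umbilical_curvature_warping; split=> [[/constant_curvature_umbilical_unique <-//|
    [K K0 /constant_curvature_umbilical_unique <-]]|]; first exact: ltW.
rewrite le_eqVlt => /predU1P[K0|K0]; [left|right].
  by rewrite /horosphere -K0; exact: constant_curvature_umbilical.
by exists (umbilical_curvature a b) => //; exact: constant_curvature_umbilical.
Qed.

End WarpingSign.

Theorem proposition2p5 (R : realType)
    (M : topologicalType) (A : set (chart R M 2)) (g : metric R M 2)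
    (a : 'rV[R]_5) (b : R) (eta : 'rV[R]_5 -> 'rV[R]_5) (h : M -> 'rV[R]_5)
    (hM : connected_manifold A) (hor : oriented_atlas A)
    (hg : riemannian A g)
    (hQ : umbilical_hypersurface a b) (heta : unit_normal_field a b eta)
    (hh : isometric_immersion A g (umbilical a b) h)
    (hmin : minimal_on (tangent_umbilical a) A h [set: M]) :
  let F : M * R -> 'rV[R]_5 := suspension eta h in
  let B := prod_atlas A in
  let reg := regular_point B F in
  [/\ smooth_map B F, forall p, H4 (F p), open reg,
      minimal_on tangent_H4 B F reg &
      zero_gauss_kronecker_on tangent_H4 B F reg] /\
  (riemannian B (induced_metric F) /\ complete B (induced_metric F) <->
   complete A g /\ (horosphere (umbilical a b) \/ equidistant (umbilical a b))).
Proof.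
move=> F B reg; have [_ _ M0 conM atlasA] := hM; have [[sh _] hh2 _] := hh.
have [al alE etaE] := unit_normal_along hQ heta
  (smooth_map_continuous atlasA sh) conM M0 hh2.
have gF := induced_metric_suspension atlasA alE etaE hh.
split.
  split.
  - exact: smooth_map_suspension hh.
  - move=> p; have [hp _] := hh2 p.1; have [tp _ ee] := heta.2 _ (hh2 p.1).
    exact: H4_combination.
  - exact: open_regular_suspension alE etaE hh.
  - exact: minimal_suspension alE etaE hh hmin.
  - exact: zero_gauss_kronecker_suspension alE etaE hh hmin.
rewrite (horosphere_or_equidistantE hQ alE).
have mu_gt0 : (al * b) ^+ 2 <= 1 -> forall t, 0 < warping (al * b) t.
  by move=> be1 t; exact: cosh_sinh.
have mu_cont := @continuous_warping R (al * b).
split=> [[hgF cF]|[cA be1]].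
  (* A slice vector at height [t] has squared length [mu^2 g], which must be positive for a
     Riemannian metric. *)
  have mu0 t : warping (al * b) t != 0.
    have [p _] := M0; have [_ covA _] := atlasA; have [c Ac cp] := covA p.
    have [_ /(_ (prod_chart c) (p, t) (imageP _ Ac) (conj cp I))[_ pos] _] := hgF.
    apply/eqP => mut; have := pos (row_mx (delta_mx 0 0) 0).
    rewrite gF // bilin_block mut expr0n mul0r add0r /height row_mxKr mxE mulr0 ltxx.
    have v0 : row_mx (delta_mx 0 0) 0 != 0 :> 'rV[R]_(2 + 1).
      apply/eqP => /rowP/(_ (lshift 1 0)); rewrite row_mxEl !mxE !eqxx => /eqP.
      by rewrite oner_eq0.
    by move=> /(_ v0).
  (* Absence of zeros forces [be^2 <= 1], which in turn makes [mu] positive, as the comparison of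
     lengths requires. *)
  have be1 := warping_neq0_le1 mu0; split=> //.
  exact: (complete_base atlasA hg hgF gF mu_cont (mu_gt0 be1) (warping0 _) cF).
have hgF : riemannian B (induced_metric F).
  by apply: (riemannian_suspension atlasA hg alE etaE hh) => t; rewrite gt_eqF // mu_gt0.
split=> //; exact: (complete_warped atlasA hg hgF gF mu_cont (mu_gt0 be1) cA).
Qed.
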